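(* Fix $\alpha\in(0,1)$ and $d\ge 1$. Let $v:\mathbb{R}^d\times(0,\tau)\to\mathbb{R}^d$ satisfy the standing assumption below, and let $\phi^\tau$ be the time-$\tau$ flow map of $\dot x(t)=v(x(t),t)$, $t\in(0,\tau)$, $x(0)=x_0\in\mathbb{R}^d$. Let $\Omega\subset\mathbb{R}^d$ be compact. Then for every $\varepsilon>0$ and $\tau>0$ there exist $L\in\mathbb{N}$ and a leaky-ReLU network $f_L\in\mathcal{N}_d(L)$ (width $d$, depth $L$) such that $\|f_L(x)-\phi^\tau(x)\|\le\varepsilon$ for all $x\in\Omega$.
   Context: Leaky-ReLU: for $\alpha\in(0,1)$, $\sigma_\alpha(x)=\max(\alpha x,x)$, applied componentwise to vectors. The class $\mathcal{N}_d(L)$ of leaky-ReLU networks of width $d$ and depth $L$ consists of all maps $f_L:\mathbb{R}^d\to\mathbb{R}^d$ defined recursively by $f_0(x)=W^{[0]}x+b^{[0]}$, $f_k(x)=W^{[k]}\sigma_\alpha(f_{k-1}(x))+b^{[k]}$ for $k=1,\dots,L$, with arbitrary $W^{[k]}\in\mathbb{R}^{d\times d}$, $b^{[k]}\in\mathbb{R}^d$. Standing assumption on $v$: $v(x,t)$ is Lipschitz continuous in $x\in\mathbb{R}^d$ and piecewise smooth in $t\in(0,\tau)$, and on each piece $v$ is continuous in $(x,t)$. The flow map $\phi^\tau$ sends $x_0$ to $x(\tau)$. *)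

(* Defs.v *)
From HB Require Import structures.
From mathcomp Require Import all_boot all_order all_algebra.
From mathcomp Require Import all_classical all_reals all_analysis.
Set Implicit Arguments. Unset Strict Implicit. Unset Printing Implicit Defensive.
Import Order.TTheory GRing.Theory Num.Theory.
Import numFieldNormedType.Exports.
Local Open Scope classical_set_scope.
Local Open Scope ring_scope.

Section Defs.
Variable R : realType.

Definition enorm (d : nat) (x : 'cV[R]_d) : R :=
  Num.sqrt (\sum_(i < d) (x i 0) ^+ 2).

Definition leaky (a y : R) : R := Num.max (a * y) y.
Definition sigma_leaky (a : R) (d : nat) (x : 'cV[R]_d) : 'cV[R]_d :=
  map_mx (leaky a) x.

Fixpoint lrelu_net (a : R) (d : nat) (W : nat -> 'M[R]_d) (b : nat -> 'cV[R]_d)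
    (k : nat) (x : 'cV[R]_d) : 'cV[R]_d :=
  match k with
  | 0%N => W 0%N *m x + b 0%N
  | k'.+1 => W k'.+1 *m sigma_leaky a (lrelu_net a W b k' x) + b k'.+1
  end.

Definition in_net_class (a : R) (d L : nat) (f : 'cV[R]_d -> 'cV[R]_d) : Prop :=
  exists (W : nat -> 'M[R]_d) (b : nat -> 'cV[R]_d),
    forall x, f x = lrelu_net a W b L x.

Definition lipschitz_in_x (d : nat) (tau : R) (v : 'cV[R]_d -> R -> 'cV[R]_d) :=
  exists K : R, forall x y t, 0 < t < tau ->
    enorm (v x t - v y t) <= K * enorm (x - y).

Definition smooth_on (d : nat) (a b : R) (g : R -> 'cV[R]_d) : Prop :=
  forall (n : nat) (t : R), a < t < b ->
    derivable (iter n (fun h => derive1 h) g) t 1.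

Definition piecewise_smooth_in_t (d : nat) (tau : R)
    (v : 'cV[R]_d -> R -> 'cV[R]_d) : Prop :=
  exists P : seq R, forall a b : R, 0 <= a -> b <= tau ->
    (forall p, p \in P -> ~ (a < p < b)) ->
    (forall x, smooth_on a b (v x)) /\
    {within [set q : 'cV[R]_d * R | a < q.2 < b],
       continuous (fun q : 'cV[R]_d * R => v q.1 q.2)}.

Definition standing_assumption (d : nat) (tau : R)
    (v : 'cV[R]_d -> R -> 'cV[R]_d) : Prop :=
  lipschitz_in_x tau v /\ piecewise_smooth_in_t tau v.

Definition ode_solution (d : nat) (tau : R) (v : 'cV[R]_d -> R -> 'cV[R]_d)
    (x0 : 'cV[R]_d) (x : R -> 'cV[R]_d) : Prop :=
  {within `[0, tau], continuous x} /\ x 0 = x0 /\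
  exists S : seq R, forall t, 0 < t < tau -> t \notin S ->
    derivable x t 1 /\ 'D_1 x t = v (x t) t.

Definition is_flow_map (d : nat) (tau : R) (v : 'cV[R]_d -> R -> 'cV[R]_d)
    (phi : 'cV[R]_d -> 'cV[R]_d) : Prop :=
  forall x0, exists x, ode_solution tau v x0 x /\ phi x0 = x tau.

End Defs.

(* Main.v *)
Require Import Defs.
From HB Require Import structures.
From mathcomp Require Import all_boot all_order all_algebra.
From mathcomp Require Import all_classical all_reals all_analysis.
From mathcomp Require Import ring lra.
Import Order.TTheory GRing.Theory Num.Theory.
Import numFieldNormedType.Exports.
Local Open Scope classical_set_scope.
Local Open Scope ring_scope.
Set Implicit Arguments. Unset Strict Implicit. Unset Printing Implicit Defensive.

(** Networks of width [d] form a monoid under composition, containing all affine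
maps and, on any ball, the leaky ReLU acting on a single coordinate.  Composing
one-variable hinges gives every increasing map with slopes in
[[alpha, 1/alpha]] up to a small error; conjugating by linear maps then gives
one Euler step, [x + h a exp (l x) e_j], with error [o(h)].  The fields whose
Euler steps are reached with error [o(h)] are closed under sums and locally
uniform limits, and sums of exponentials of linear forms are dense by a
Stone-Weierstrass argument, so every Lipschitz field is reached.

The Euler scheme is then compared with the exact trajectories only, so no flow
between intermediate times has to be constructed.  The field may be unbounded
near the breakpoints, but the difference of two solutions is Lipschitz in time
by Gronwall's inequality, so the trajectories are uniformly equicontinuous; the
identity map is a good enough step across a breakpoint.  The steps are chained
by induction along the interval. *)

(** * Maximum norm and networks *)

Section MaxNorm.
Variables (R : realType) (d : nat).
Implicit Types x y : 'cV[R]_d.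

Lemma coord_norm_le x i : `|x i 0| <= `|x|.
Proof.
rewrite [leRHS]/Num.Def.normr /= mx_normrE.
exact: (le_bigmax _ (fun ij : 'I_d * 'I_1 => `|x ij.1 ij.2|) (i, 0)).
Qed.

Lemma cV_norm_le x e : 0 <= e -> (forall i, `|x i 0| <= e) -> `|x| <= e.
Proof.
move=> e0 xe; rewrite [leLHS]/Num.Def.normr /= mx_normrE.
by apply: bigmax_le => // -[i j] _ /=; rewrite ord1.
Qed.

Lemma coord_norm_enorm x i : `|x i 0| <= enorm x.
Proof.
rewrite -sqrtr_sqr ler_wsqrtr // (bigD1 i) //= lerDl.
by apply: sumr_ge0 => j _; exact: sqr_ge0.
Qed.

Lemma norm_enorm x : `|x| <= enorm x.
Proof.
by apply: cV_norm_le => [|i]; [exact: sqrtr_ge0 | exact: coord_norm_enorm].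
Qed.

Lemma enorm_norm x : enorm x <= d%:R * `|x|.
Proof.
have xd : 0 <= d%:R * `|x| by rewrite mulr_ge0.
rewrite -(ger0_norm xd) -sqrtr_sqr ler_wsqrtr //.
apply: (@le_trans _ _ (\sum_(i < d) `|x| ^+ 2)).
  apply: ler_sum => i _; rewrite -[leLHS]real_normK ?num_real //.
  by rewrite lerXn2r ?nnegrE // coord_norm_le.
rewrite sumr_const card_ord exprMn -[leLHS]mulr_natl ler_wpM2r ?sqr_ge0 //.
by rewrite -natrX ler_nat; case: (d) => // n; exact: leq_pmulr.
Qed.

Lemma mulmx_norm_le (A : 'M[R]_d) :
  exists2 C, 0 <= C & forall x, `|A *m x| <= C * `|x|.
Proof.
have C0 : 0 <= \sum_i \sum_j `|A i j| by apply: sumr_ge0 => i _; apply: sumr_ge0.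
exists (\sum_i \sum_j `|A i j|) => // x; apply: cV_norm_le => [|i].
  by rewrite mulr_ge0.
rewrite mxE; apply: (le_trans (ler_norm_sum _ _ _)).
apply: (@le_trans _ _ (\sum_j `|A i j| * `|x|)).
  by apply: ler_sum => j _; rewrite normrM ler_wpM2l // coord_norm_le.
rewrite -mulr_suml ler_wpM2r // [leRHS](bigD1 i) //= lerDl.
by apply: sumr_ge0 => k _; apply: sumr_ge0.
Qed.

Lemma cV_eq x y : (forall i, x i 0 = y i 0) -> x = y.
Proof. by move=> xy; apply/matrixP => i j; rewrite ord1. Qed.

End MaxNorm.

Section Nets.
Variables (R : realType) (alpha : R) (d : nat).
Hypothesis alpha01 : 0 < alpha < 1.
Local Notation cV := 'cV[R]_d.
Implicit Types (x y : cV) (f g : cV -> cV).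

Definition net f := exists L, in_net_class alpha L f.

(** Layers above [k] are never read, so a conditional on the index can replace or append the
    outermost layer. *)
Lemma lrelu_net_ext (W W' : nat -> 'M[R]_d) (b b' : nat -> cV) k :
  (forall i, (i <= k)%N -> W i = W' i /\ b i = b' i) ->
  lrelu_net alpha W b k =1 lrelu_net alpha W' b' k.
Proof.
elim: k => [|k IH] WW x /=; first by have [-> ->] := WW 0%N isT.
have [-> ->] := WW k.+1 (leqnn _); rewrite IH // => i ik.
by apply: WW; rewrite (leq_trans ik).
Qed.

Lemma net_affine (A : 'M[R]_d) b : net (fun x => A *m x + b).
Proof. by exists 0%N, (fun=> A), (fun=> b). Qed.

Lemma net_ext f g : f =1 g -> net f -> net g.
Proof. by move=> /funext ->. Qed.

(** The affine map is absorbed into the last layer, so the depth is unchanged. *)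
Lemma net_post_affine f (A : 'M[R]_d) b : net f -> net (fun x => A *m f x + b).
Proof.
move=> [L [W [c fE]]]; exists L.
exists (fun k => if k == L then A *m W L else W k).
exists (fun k => if k == L then A *m c L + b else c k) => x.
rewrite fE; case: L {fE} => [|L] /=; first by rewrite mulmxDr mulmxA addrA.
rewrite eqxx mulmxDr mulmxA addrA; congr (_ *m sigma_leaky _ _ + _ + _).
apply: lrelu_net_ext => i iL; rewrite ltn_eqF //.
Qed.

Lemma net_post_layer f (A : 'M[R]_d) b :
  net f -> net (fun x => A *m sigma_leaky alpha (f x) + b).
Proof.
move=> [L [W [c fE]]]; exists L.+1.
exists (fun k => if k == L.+1 then A else W k).
exists (fun k => if k == L.+1 then b else c k) => x.
rewrite fE /= eqxx; congr (_ *m sigma_leaky _ _ + _).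
by apply: lrelu_net_ext => i iL; rewrite ltn_eqF.
Qed.

(** Induction on the depth of the outer network: its layers are stacked one at a time on top of
    [g]. *)
Lemma net_comp f g : net f -> net g -> net (f \o g).
Proof.
move=> [L [W [b fE]]] ng.
suff: net (lrelu_net alpha W b L \o g) by apply: net_ext => x /=; rewrite fE.
by elim: L {fE} => [|L IH] /=; [exact: net_post_affine | exact: net_post_layer].
Qed.

Lemma net_id : net id.
Proof. by apply: net_ext (net_affine 1%:M 0) => x; rewrite mul1mx addr0. Qed.

Lemma leaky_lipschitz (s t : R) : `|leaky alpha s - leaky alpha t| <= `|s - t|.
Proof.
have /andP[a0 a1] := alpha01.
have l1 : s - t <= `|s - t| := ler_norm _.
have l2 : t - s <= `|s - t| by rewrite distrC ler_norm.
have lE u : leaky alpha u = if u <= 0 then alpha * u else u.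
  by rewrite /leaky; case: leP => u0; [rewrite max_l // | rewrite max_r //]; nra.
by rewrite !lE ler_norml; case: (leP s 0) => ?; case: (leP t 0) => ?;
  apply/andP; split; nra.
Qed.

Lemma net_lipschitz f : net f ->
  exists2 C, 0 <= C & forall x y, `|f x - f y| <= C * `|x - y|.
Proof.
move=> [L [W [b fE]]].
suff [C C0 CL] : exists2 C, 0 <= C &
    forall x y, `|lrelu_net alpha W b L x - lrelu_net alpha W b L y| <= C * `|x - y|.
  by exists C => // x y; rewrite !fE.
elim: L {fE} => [|L [C C0 IH]] /=.
  have [C C0 CW] := mulmx_norm_le (W 0%N); exists C => // x y.
  by rewrite opprD addrACA subrr addr0 -mulmxBr.
have [D D0 DW] := mulmx_norm_le (W L.+1).
exists (D * C) => [|x y]; first exact: mulr_ge0.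
rewrite opprD addrACA subrr addr0 -mulmxBr (le_trans (DW _)) //.
rewrite -mulrA ler_wpM2l // (le_trans _ (IH x y)) //.
apply: cV_norm_le => // i; rewrite !mxE (le_trans (leaky_lipschitz _ _)) //.
by have := coord_norm_le (lrelu_net alpha W b L x - lrelu_net alpha W b L y) i;
  rewrite !mxE.
Qed.

(** Closeness is asked on one ball at a time because the biases that linearise the activation depend
    on the radius. *)
Definition napprox f := forall M delta : R, 0 < delta ->
  exists2 g, net g & forall x, `|x| <= M -> `|f x - g x| <= delta.

Lemma net_napprox f : net f -> napprox f.
Proof. by move=> nf M e e0; exists f => // x _; rewrite subrr normr0 ltW. Qed.

(** The bound is inherited from a Lipschitz network within distance 1 of [f] on the ball. *)
Lemma napprox_bounded f M : napprox f ->
  exists2 C, 0 <= C & forall x, `|x| <= M -> `|f x| <= C.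
Proof.
move=> nf; have [M0|M0] := leP 0 M; last first.
  by exists 0 => // x xM; have := le_trans (normr_ge0 x) xM; rewrite leNgt M0.
have [g ng fg] := nf M 1 ltr01; have [C C0 gC] := net_lipschitz ng.
exists (1 + C * M + `|g 0|) => [|x xM]; first by rewrite !addr_ge0 ?mulr_ge0.
rewrite -[f x](subrK (g x)) (le_trans (ler_normD _ _)) // -addrA lerD ?fg //.
rewrite -[g x](subrK (g 0)) (le_trans (ler_normD _ _)) // lerD //.
by rewrite (le_trans (gC _ _)) // subr0 ler_wpM2l.
Qed.

Lemma napprox_comp f g : napprox f -> napprox g -> napprox (f \o g).
Proof.
move=> nf ng M e e0.
have [M' _ gM'] := napprox_bounded M ng.
(* The outer approximant is fixed first, on a ball containing the image of [g], so that its
   Lipschitz constant can set the tolerance for the inner one. *)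
have [f1 nf1 ff1] := nf M' (e / 2) (divr_gt0 e0 (ltr0n _ 2)).
have [C C0 f1C] := net_lipschitz nf1.
have C1 : 0 < C + 1 by rewrite ltr_wpDl.
have [g1 ng1 gg1] := ng M (e / 2 / (C + 1)) (divr_gt0 (divr_gt0 e0 (ltr0n _ 2)) C1).
exists (f1 \o g1) => [|x xM /=]; first exact: net_comp.
rewrite -[f (g x)](subrK (f1 (g x))) -addrA (le_trans (ler_normD _ _)) //.
rewrite (splitr e) lerD ?ff1 ?gM' // (le_trans (f1C _ _)) //.
rewrite (@le_trans _ _ ((C + 1) * `|g x - g1 x|)) ?ler_wpM2r ?lerDl //.
by rewrite mulrC -ler_pdivlMr // gg1.
Qed.

Lemma napprox_ext f g : f =1 g -> napprox f -> napprox g.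
Proof. by move=> /funext ->. Qed.

(** * One-variable maps acting on a single coordinate *)

Definition ecol (j : 'I_d) : cV := \col_i (i == j)%:R.

Definition setc j (r : R -> R) x : cV := x + (r (x j 0) - x j 0) *: ecol j.

Lemma setcE j r x i : setc j r x i 0 = if i == j then r (x i 0) else x i 0.
Proof.
rewrite !mxE; case: eqVneq => [->|_]; first by rewrite mulr1 addrC subrK.
by rewrite mulr0 addr0.
Qed.

Definition coord_napprox (r : R -> R) := forall j, napprox (setc j r).

Lemma coord_napprox_comp r s :
  coord_napprox r -> coord_napprox s -> coord_napprox (r \o s).
Proof.
move=> nr ns j; apply: napprox_ext (napprox_comp (nr j) (ns j)) => x.
by apply: cV_eq => i; rewrite !setcE; case: eqP => // <-.
Qed.

Lemma coord_napprox_translation c : coord_napprox (fun t => t + c).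
Proof.
move=> j; apply: net_napprox; apply: net_ext (net_affine 1%:M (c *: ecol j)).
by move=> x; rewrite mul1mx /setc [x j 0 + c]addrC addrK.
Qed.

(* On the other coordinates a large bias keeps the activation in its linear
   regime on the given ball. *)
Lemma coord_napprox_leaky (a b c e : R) :
  coord_napprox (fun t => a * leaky alpha (b * t + c) + e).
Proof.
move=> j M dl dl0.
pose A := diag_mx (\row_i (if i == j then b else 1)) : 'M[R]_d.
pose A' := diag_mx (\row_i (if i == j then a else 1)) : 'M[R]_d.
pose u : cV := \col_i (if i == j then c else M).
pose u' : cV := \col_i (if i == j then e else - M).
exists (fun x => A' *m sigma_leaky alpha (A *m x + u) + u').
  by apply: net_post_layer; exact: net_affine.
move=> x xM; apply: cV_norm_le => [|i]; first exact: ltW.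
suff E : setc j (fun t => a * leaky alpha (b * t + c) + e) x i 0 =
    (A' *m sigma_leaky alpha (A *m x + u) + u') i 0.
  by rewrite mxE [X in _ + X]mxE E subrr normr0 ltW.
rewrite setcE mul_diag_mx [A *m x]mul_diag_mx !mxE.
case: eqP => // _; rewrite !mul1r.
have : `|x i 0| <= M := le_trans (coord_norm_le x i) xM.
rewrite ler_norml /leaky => /andP[x1 x2]; have /andP[a0 a1] := alpha01.
by rewrite max_r ?addrK // ; nra.
Qed.

Definition hinge (rho p t : R) := if t <= p then t else p + rho * (t - p).

Lemma coord_napprox_hinge_inv p : coord_napprox (hinge alpha^-1 p).
Proof.
have /andP[a0 a1] := alpha01.
suff -> : hinge alpha^-1 p = fun t => alpha^-1 * leaky alpha (1 * t + - p) + p.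
  exact: coord_napprox_leaky.
apply/funext => t; rewrite /hinge /leaky mul1r; case: leP => tp.
  by rewrite max_l ?mulKf ?subrK ?gt_eqF //; nra.
by rewrite max_r 1?addrC //; nra.
Qed.

(** Negating input and output of the activation swaps its two slopes, which puts slope 1 on the left
    of [p] and [alpha] on the right. *)
Lemma coord_napprox_hinge p : coord_napprox (hinge alpha p).
Proof.
have /andP[a0 a1] := alpha01.
suff -> : hinge alpha p = fun t => -1 * leaky alpha (-1 * t + p) + p.
  exact: coord_napprox_leaky.
apply/funext => t; rewrite /hinge /leaky !mulN1r; case: leP => tp.
  by rewrite max_r; [lra | nra].
by rewrite max_l; [lra | nra].
Qed.

Lemma hinge_homo rho p : 0 < rho -> {homo hinge rho p : s t / s <= t}.
Proof. by move=> r0 s t st; rewrite /hinge; case: (leP s p) => ?; case: (leP t p) => ?; nra. Qed.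

(** A first hinge at [p] gives slope [1/alpha] (or [alpha]), and an opposite hinge restores slope 1
    as soon as the gain [m - eta] is reached. *)
Lemma slope_bump p eta m : 0 < eta -> alpha * eta <= m <= eta / alpha ->
  exists beta, [/\ coord_napprox beta, {homo beta : s t / s <= t},
    forall t, t <= p -> beta t = t
    & forall t, p + eta <= t -> beta t = t - eta + m].
Proof.
move=> eta0 /andP[m1 m2]; have /andP[a0 a1] := alpha01.
have ai0 : 0 < alpha^-1 by rewrite invr_gt0.
have aai : alpha * alpha^-1 = 1 by rewrite mulfV // gt_eqF.
have ai1 : 1 < alpha^-1 by nra.
have [em|em] := leP eta m.
  (* [c] is the length, measured before the first hinge, of the piece with slope [1/alpha]; its
     right end [p + c] is sent to [p + c / alpha], where the second hinge sits. *)
  pose c := (m - eta) / (alpha^-1 - 1).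
  have cE : c * (alpha^-1 - 1) = m - eta.
    by rewrite /c divfK // gt_eqF // subr_gt0.
  have c0 : 0 <= c by rewrite divr_ge0 // ?subr_ge0 // ltW.
  have ce : c <= eta by rewrite ler_pdivrMr ?subr_gt0 // mulrBr; lra.
  exists (hinge alpha (p + c / alpha) \o hinge alpha^-1 p); split.
  - exact: coord_napprox_comp (coord_napprox_hinge _) (coord_napprox_hinge_inv _).
  - by move=> s t st /=; do 2!apply: hinge_homo => //.
  - move=> t tp /=; rewrite /hinge tp; case: leP => //; nra.
  - move=> t tp /=; rewrite /hinge; case: (leP t p) => [|_].
      by move=> tp'; have -> : t = p; [lra | case: leP; nra].
    case: leP => h; last first.
      have -> : alpha * (p + alpha^-1 * (t - p) - (p + c / alpha)) =
        (alpha * alpha^-1) * (t - p - c) by ring.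
      rewrite aai mul1r; nra.
    have -> : t = p + c by nra.
    by have -> : m = c * (alpha^-1 - 1) + eta; [rewrite cE subrK | ring].
pose c := (eta - m) / (1 - alpha).
have cE : c * (1 - alpha) = eta - m by rewrite /c divfK // gt_eqF // subr_gt0.
have c0 : 0 <= c by rewrite divr_ge0 // ?subr_ge0 // ltW.
have ce : c <= eta by rewrite ler_pdivrMr ?subr_gt0 //; lra.
exists (hinge alpha^-1 (p + alpha * c) \o hinge alpha p); split.
- exact: coord_napprox_comp (coord_napprox_hinge_inv _) (coord_napprox_hinge _).
- by move=> s t st /=; do 2!apply: hinge_homo => //.
- move=> t tp /=; rewrite /hinge tp; case: leP => //; nra.
- move=> t tp /=; rewrite /hinge; case: (leP t p) => [|_].
    by move=> tp'; have -> : t = p; [lra | case: leP; nra].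
  case: leP => h; last first.
    have -> : alpha^-1 * (p + alpha * (t - p) - (p + alpha * c)) =
      (alpha * alpha^-1) * (t - p - c) by ring.
    rewrite aai mul1r; nra.
  have -> : t = p + c by nra.
  by have -> : m = eta - c * (1 - alpha); [rewrite cE; ring | ring].
Qed.

(* The interpolant agrees with [g] at the nodes [-M + k eta] and is monotone
   between them; beyond the last node it continues with slope 1, which is what
   the next bump acts on. *)
Lemma coord_napprox_monotone (g : R -> R) (M delta : R) : 0 < M -> 0 < delta ->
  (forall s t, - M <= s -> s <= t -> t <= M ->
     alpha * (t - s) <= g t - g s <= (t - s) / alpha) ->
  exists2 r, coord_napprox r & forall t, `|t| <= M -> `|g t - r t| <= delta.
Proof.
move=> M0 dl0 gM; have /andP[a0 a1] := alpha01.
(* Enough nodes that [eta / alpha <= delta]: the increment of [g] over one cell then stays within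
   the tolerance. *)
have [n nM] : exists n, 2 * M / (alpha * delta) < n.+1%:R.
  by exists (Num.truncn (2 * M / (alpha * delta))); exact: truncnS_gt.
pose eta := 2 * M / n.+1%:R.
have eta0 : 0 < eta by rewrite divr_gt0 // mulr_gt0.
have etad : eta / alpha <= delta.
  move: nM; rewrite ltr_pdivrMr ?mulr_gt0 // => nM.
  by rewrite ler_pdivrMr // ler_pdivrMr //; lra.
have etaM : n.+1%:R * eta = 2 * M by rewrite mulrC divfK.
pose s k := - M + k%:R * eta.
have s1 k : s k.+1 = s k + eta by rewrite /s -natr1; ring.
have sM k : (k <= n.+1)%N -> s k <= M.
  move=> kn; rewrite /s; have : k%:R * eta <= n.+1%:R * eta.
    by rewrite ler_wpM2r ?ler_nat // ltW.
  by rewrite etaM; lra.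
have sm k : - M <= s k by rewrite /s lerDl mulr_ge0 // ltW.
have main k : (k <= n.+1)%N -> exists G, [/\ coord_napprox G,
    forall t, s k <= t -> G t = g (s k) + t - s k &
    forall t, - M <= t -> t <= s k -> G t <= g (s k) /\ `|g t - G t| <= delta].
  elim: k => [|k IH] kn.
    exists (fun t => t + (g (s 0%N) - s 0%N)); split.
    - exact: coord_napprox_translation.
    - by move=> t _; ring.
    - move=> t; rewrite /s mul0r addr0 => t1 t2; have -> : t = - M by lra.
      have -> : - M + (g (- M) - - M) = g (- M) by ring.
      by rewrite subrr normr0; split=> //; exact: ltW.
  have [|G [nG G1 G2]] := IH; first exact: ltnW.
  have gs : alpha * eta <= g (s k.+1) - g (s k) <= eta / alpha.
    have <- : s k.+1 - s k = eta by rewrite s1; ring.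
    by apply: gM; [exact: sm | rewrite s1 lerDl ltW | exact: sM].
  have [beta [nb hb b1 b2]] := slope_bump (g (s k)) eta0 gs.
  have be : beta (g (s k) + eta) = g (s k.+1) by rewrite b2 //; ring.
  exists (beta \o G); split; first exact: coord_napprox_comp.
    move=> t tk /=; rewrite G1; last by rewrite (le_trans _ tk) // s1 lerDl ltW.
    have tk' : g (s k) + eta <= g (s k) + t - s k by rewrite s1 in tk; lra.
    by rewrite (b2 _ tk') s1; ring.
  move=> t Mt tk /=; have [tk'|tk'] := leP t (s k).
    have [Gt gt] := G2 t Mt tk'; rewrite b1 //; split => //.
    by rewrite (le_trans Gt) // -subr_ge0 (le_trans _ (proj1 (andP gs))) // mulr_ge0 // ltW.
  have GE : G t = g (s k) + t - s k by rewrite G1 // ltW.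
  (* From here [g t] and [beta (G t)] are trapped in the same interval from [g (s k)] to
     [g (s k.+1)]. *)
  have Gl : beta (G t) <= g (s k.+1).
    by rewrite -be hb // GE; rewrite s1 in tk; lra.
  have Gm : g (s k) <= beta (G t).
    by rewrite -[leLHS](b1 _ (lexx _)) hb // GE; lra.
  split=> //; have := gM (s k) t (sm k) (ltW tk') (le_trans tk (sM _ kn)).
  have := gM t (s k.+1) (le_trans (sm k) (ltW tk')) tk (sM _ kn).
  move=> /andP[h1 _] /andP[h2 _]; move: gs => /andP[_ gs].
  have h3 : g t <= g (s k.+1) by rewrite -subr_ge0 (le_trans _ h1) // mulr_ge0 ?subr_ge0 // ltW.
  have h4 : g (s k) <= g t by rewrite -subr_ge0 (le_trans _ h2) // mulr_ge0 ?subr_ge0 // ltW.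
  by rewrite (le_trans _ etad) // ler_norml; lra.
have [G [nG _ G2]] := main _ (leqnn n.+1).
have sn : s n.+1 = M by rewrite /s etaM; ring.
exists G => // t; rewrite ler_norml => /andP[t1 t2].
by have [] := G2 t t1; rewrite ?sn.
Qed.

End Nets.

(** * Density of sums of exponentials *)

(** For [s <= t], write [expR s = expR t * expR (s - t)] and use the tangent bound
    [1 + u <= expR u]. *)
Lemma expR_lip (R : realType) (M s t : R) : s <= M -> t <= M ->
  `|expR s - expR t| <= expR M * `|s - t|.
Proof.
wlog st : s t / s <= t.
  by move=> H sM tM; have [/H|/ltW/H] := leP s t; last rewrite distrC [`|s - t|]distrC; apply.
move=> sM tM; rewrite distrC [`|s - t|]distrC.
rewrite !ger0_norm ?subr_ge0 ?ler_expR //.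
apply: (@le_trans _ _ (expR t * (t - s))).
  have -> : expR s = expR t * expR (s - t) by rewrite -expRD addrC subrK.
  by have := expR_ge1Dx (s - t); have := expR_gt0 t; nra.
by rewrite ler_wpM2r ?subr_ge0 // ler_expR.
Qed.

Section ExpSums.
Variables (R : realType) (d : nat).
Local Notation cV := 'cV[R]_d.
Implicit Types (x y : cV) (f g : cV -> R) (l : 'rV[R]_d).

Definition lin l x : R := (l *m x) 0 0.

Lemma linDl l m x : lin (l + m) x = lin l x + lin m x.
Proof. by rewrite /lin mulmxDl mxE. Qed.

Lemma linZl (a : R) l x : lin (a *: l) x = a * lin l x.
Proof. by rewrite /lin -scalemxAl mxE. Qed.

Lemma linNl l x : lin (- l) x = - lin l x.
Proof. by rewrite /lin mulNmx mxE. Qed.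

Lemma lin0l x : lin 0 x = 0.
Proof. by rewrite /lin mul0mx mxE. Qed.

Lemma linDr l x y : lin l (x + y) = lin l x + lin l y.
Proof. by rewrite /lin mulmxDr mxE. Qed.

Lemma linZr (a : R) l x : lin l (a *: x) = a * lin l x.
Proof. by rewrite /lin -scalemxAr mxE. Qed.

Lemma linBr l x y : lin l (x - y) = lin l x - lin l y.
Proof. by rewrite linDr -scaleN1r linZr mulN1r. Qed.

Lemma lin_coord j x : lin (ecol R j)^T x = x j 0.
Proof.
rewrite /lin mxE (bigD1 j) //= !mxE eqxx mul1r big1 ?addr0 // => i ij.
by rewrite !mxE (negbTE ij) mul0r.
Qed.

Lemma lin_ecol l j : lin l (ecol R j) = l 0 j.
Proof.
rewrite /lin mxE (bigD1 j) //= !mxE eqxx mulr1 big1 ?addr0 // => i ij.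
by rewrite !mxE (negbTE ij) mulr0.
Qed.

Lemma lin_norm_le l : exists2 C, 0 <= C & forall x, `|lin l x| <= C * `|x|.
Proof.
exists (\sum_j `|l 0 j|) => [|x]; first exact: sumr_ge0.
rewrite /lin mxE (le_trans (ler_norm_sum _ _ _)) // mulr_suml.
by apply: ler_sum => j _; rewrite normrM ler_wpM2l // coord_norm_le.
Qed.

Lemma norm_ecol_le (a : R) j : `|a *: ecol R j : cV| <= `|a|.
Proof.
apply: cV_norm_le => // i; rewrite !mxE; case: eqP => _; rewrite ?mulr1 //.
by rewrite mulr0 normr0.
Qed.

Inductive expsum : (cV -> R) -> Prop :=
| expsum1 (a : R) l : expsum (fun x => a * expR (lin l x))
| expsumD f g : expsum f -> expsum g -> expsum (fun x => f x + g x).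

(** Exponents add, so the sums of exponentials form an algebra, as a Stone-Weierstrass argument
    requires. *)
Lemma expsumM f g : expsum f -> expsum g -> expsum (fun x => f x * g x).
Proof.
elim=> [a l|f1 f2 _ IH1 _ IH2] eg.
  elim: eg => [b m|g1 g2 _ IH1 _ IH2].
    rewrite (_ : (fun x => _) = fun x => (a * b) * expR (lin (l + m) x)).
      exact: expsum1.
    by apply/funext => x; rewrite linDl expRD; ring.
  rewrite (_ : (fun x => _) = fun x => a * expR (lin l x) * g1 x + a * expR (lin l x) * g2 x).
    exact: expsumD.
  by apply/funext => x; ring.
rewrite (_ : (fun x => _) = fun x => f1 x * g x + f2 x * g x).
  by apply: expsumD; [exact: IH1 | exact: IH2].
by apply/funext => x; ring.
Qed.

Lemma expsum_bounded f M : expsum f ->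
  exists2 C, 0 <= C & forall x, `|x| <= M -> `|f x| <= C.
Proof.
elim=> [a l|f1 f2 _ [C C0 fC] _ [D D0 gD]].
  have [C C0 lC] := lin_norm_le l.
  exists (`|a| * expR (C * M)) => [|x xM]; first by rewrite mulr_ge0 ?expR_ge0.
  rewrite normrM ler_wpM2l // ger0_norm ?expR_ge0 // ler_expR.
  by rewrite (le_trans (ler_norm _)) // (le_trans (lC _)) // ler_wpM2l.
exists (C + D) => [|x xM]; first exact: addr_ge0.
by rewrite (le_trans (ler_normD _ _)) // lerD ?fC ?gD.
Qed.

Definition expsum_lim f := forall M delta : R, 0 < delta ->
  exists2 g, expsum g & forall x, `|x| <= M -> `|f x - g x| <= delta.

Lemma expsum_lim_ext f g : f =1 g -> expsum_lim f -> expsum_lim g.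
Proof. by move=> /funext ->. Qed.

Lemma expsum_expsum_lim f : expsum f -> expsum_lim f.
Proof. by move=> ef M e e0; exists f => // x _; rewrite subrr normr0 ltW. Qed.

Lemma expsum_lim_lim f : (forall M delta : R, 0 < delta ->
    exists2 g, expsum_lim g & forall x, `|x| <= M -> `|f x - g x| <= delta) ->
  expsum_lim f.
Proof.
move=> ef M e e0; have e2 : 0 < e / 2 by rewrite divr_gt0.
have [g eg fg] := ef M _ e2; have [h eh gh] := eg M _ e2.
exists h => // x xM; rewrite -[f x](subrK (g x)) -addrA.
by rewrite (le_trans (ler_normD _ _)) // (splitr e) lerD ?fg ?gh.
Qed.

Lemma expsum_lim_bounded f M : expsum_lim f ->
  exists2 C, 0 <= C & forall x, `|x| <= M -> `|f x| <= C.
Proof.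
move=> ef; have [g eg fg] := ef M 1 ltr01; have [C C0 gC] := expsum_bounded M eg.
exists (1 + C) => [|x xM]; first by rewrite addr_ge0.
rewrite -[f x](subrK (g x)) (le_trans (ler_normD _ _)) // lerD ?fg ?gC //.
Qed.

Lemma expsum_lim_cst (c : R) : expsum_lim (fun=> c).
Proof.
apply: expsum_lim_ext (expsum_expsum_lim (expsum1 c 0)) => x.
by rewrite lin0l expR0 mulr1.
Qed.

Lemma expsum_limD f g :
  expsum_lim f -> expsum_lim g -> expsum_lim (fun x => f x + g x).
Proof.
move=> ef eg M e e0; have e2 : 0 < e / 2 by rewrite divr_gt0.
have [f1 ef1 ff1] := ef M _ e2; have [g1 eg1 gg1] := eg M _ e2.
exists (fun x => f1 x + g1 x) => [|x xM]; first exact: expsumD.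
by rewrite opprD addrACA (le_trans (ler_normD _ _)) // (splitr e) lerD ?ff1 ?gg1.
Qed.

Lemma expsum_limM f g :
  expsum_lim f -> expsum_lim g -> expsum_lim (fun x => f x * g x).
Proof.
move=> ef eg M e e0; have e2 : 0 < e / 2 by rewrite divr_gt0.
have [C C0 gC] := expsum_lim_bounded M eg.
have C1 : 0 < C + 1 by rewrite ltr_wpDl.
(* [f1] is chosen before [g1], whose tolerance depends on the bound [D] for [f1]. *)
have [f1 ef1 ff1] := ef M _ (divr_gt0 e2 C1).
have [D D0 fD] := expsum_bounded M ef1.
have D1 : 0 < D + 1 by rewrite ltr_wpDl.
have [g1 eg1 gg1] := eg M _ (divr_gt0 e2 D1).
exists (fun x => f1 x * g1 x) => [|x xM]; first exact: expsumM.
have -> : f x * g x - f1 x * g1 x = (f x - f1 x) * g x + f1 x * (g x - g1 x) by ring.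
rewrite (le_trans (ler_normD _ _)) // (splitr e) lerD // normrM.
  have := ff1 x xM; rewrite ler_pdivlMr //; apply: le_trans.
  by rewrite ler_wpM2l // (le_trans (gC x xM)) // lerDl.
have := gg1 x xM; rewrite ler_pdivlMr //; apply: le_trans.
by rewrite mulrC ler_wpM2l // (le_trans (fD x xM)) // lerDl.
Qed.

Lemma expsum_limZ (c : R) f : expsum_lim f -> expsum_lim (fun x => c * f x).
Proof. by move=> ef; apply: expsum_limM => //; exact: expsum_lim_cst. Qed.

(** The upper bound comes from [expR t * expR (- t) = 1] and [1 - t <= expR (- t)], which give
    [expR t <= 1 / (1 - t)]. *)
Lemma expR_tangent (t : R) : `|t| <= 2^-1 -> `|expR t - 1 - t| <= 2 * t ^+ 2.
Proof.
rewrite ler_norml => /andP[t1 t2].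
have h1 := expR_ge1Dx t; have h2 := expR_ge1Dx (- t).
have h3 := expRxMexpNx_1 t; have h4 := expR_gt0 t.
by rewrite ler_norml; nra.
Qed.

(* [x_j] is the limit of [(exp (e x_j) - 1) / e] as [e] tends to 0. *)
Lemma expsum_lim_coord j : expsum_lim (fun x => x j 0).
Proof.
move=> M dl dl0.
(* The first bound puts [e * x j 0] in the range of the tangent estimate, the second makes the
   remainder divided by [e] at most [dl]. *)
pose e := Num.min ((2 * (`|M| + 1))^-1) (dl / (2 * (`|M| + 1) ^+ 2)).
have M1 : 0 < `|M| + 1 by rewrite ltr_wpDl.
have e0 : 0 < e.
  by rewrite lt_min invr_gt0 divr_gt0 ?mulr_gt0 ?exprn_gt0.
have eM1 : e * (`|M| + 1) <= 2^-1.
  rewrite -ler_pdivlMr // -invfM.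
  by rewrite ge_min lexx.
have eM2 : 2 * e * (`|M| + 1) ^+ 2 <= dl.
  by rewrite mulrAC mulrC -ler_pdivlMr ?mulr_gt0 ?exprn_gt0 // ge_min lexx orbT.
exists (fun x => e^-1 * expR (lin (e *: (ecol R j)^T) x) + (- e^-1) * expR (lin 0 x)).
  by apply: expsumD; exact: expsum1.
move=> x xM; rewrite linZl lin_coord lin0l expR0.
have xj : `|x j 0| <= `|M| + 1.
  by rewrite (le_trans (coord_norm_le x j)) // (le_trans xM) // ler_wpDr // ler_norm.
set t := e * x j 0.
have tl : `|t| <= e * (`|M| + 1) by rewrite normrM gtr0_norm // ler_wpM2l // ltW.
have := expR_tangent (le_trans tl eM1).
have -> : x j 0 - (e^-1 * expR t + - e^-1 * 1) = - (e^-1 * (expR t - 1 - t)).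
  by rewrite /t; field; rewrite gt_eqF.
rewrite normrN normrM gtr0_norm ?invr_gt0 // ler_pdivrMl // => /le_trans; apply.
rewrite -real_normK ?num_real //.
apply: (@le_trans _ _ (2 * (e * (`|M| + 1)) ^+ 2)).
  by rewrite ler_wpM2l // lerXn2r ?nnegrE // mulr_ge0 // ltW.
have -> : 2 * (e * (`|M| + 1)) ^+ 2 = e * (2 * e * (`|M| + 1) ^+ 2) by ring.
by rewrite ler_wpM2l // ltW.
Qed.

(** The classical polynomial iteration increasing to the absolute value on [[-1, 1]]. *)
Fixpoint abs_approx n (t : R) : R :=
  if n is n'.+1 then
    abs_approx n' t + 2^-1 * (t ^+ 2 - abs_approx n' t ^+ 2)
  else 0.

(** With [e] the current error, one iteration leaves at most [e - e^2 / 2], whence a decay like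
    [2 / (n + 2)]. *)
Lemma abs_approx_bounds n t : `|t| <= 1 ->
  0 <= abs_approx n t <= `|t| /\ (`|t| - abs_approx n t) * n.+2%:R <= 2.
Proof.
move=> t1; have t0 := normr_ge0 t; elim: n => [|n [/andP[u0 ut] IH]] /=.
  by rewrite subr0 lexx t0; split => //; lra.
rewrite -(real_normK (num_real t)).
set a := `|t| in t1 t0 ut IH *; set u := abs_approx n t in u0 ut IH *.
split; first by apply/andP; split; nra.
set k : R := n.+2%:R in IH.
have k2 : 2 <= k by rewrite ler_nat.
have -> : n.+3%:R = k + 1 by rewrite /k -[n.+3%:R]natr1.
have h : a - (u + 2^-1 * (a ^+ 2 - u ^+ 2)) <= (a - u) - 2^-1 * (a - u) ^+ 2 by nra.
have e0 : 0 <= a - u by rewrite subr_ge0.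
have e1 : a - u <= 1 by lra.
set e := a - u in h e0 e1 IH.
apply: (@le_trans _ _ ((e - 2^-1 * e ^+ 2) * (k + 1))).
  by rewrite ler_wpM2r //; lra.
have kk : 0 < k ^+ 2 by rewrite exprn_gt0 //; lra.
rewrite -subr_ge0 -(pmulr_rge0 _ kk).
(* The right-hand side is a sum of nonnegative terms because [k >= 2] and [e * k <= 2]. *)
have -> : k ^+ 2 * (2 - (e - 2^-1 * e ^+ 2) * (k + 1)) =
  2 + (k + 1) * (k - 2) * (2 - e * k) + 2^-1 * (k + 1) * (2 - e * k) ^+ 2 by field.
rewrite !addr_ge0 // !mulr_ge0 ?sqr_ge0 //; lra.
Qed.

(** Once [f] is scaled into [[-1, 1]] on the ball, [abs_approx] is a polynomial in it and converges
    uniformly. *)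
Lemma expsum_lim_abs f : expsum_lim f -> expsum_lim (fun x => `|f x|).
Proof.
move=> ef; apply: expsum_lim_lim => M e e0.
have [C C0 fC] := expsum_lim_bounded M ef.
have C1 : 0 < C + 1 by rewrite ltr_wpDl.
have [n nE] : exists n, 2 * (C + 1) / e < n.+1%:R.
  by exists (Num.truncn (2 * (C + 1) / e)); exact: truncnS_gt.
exists (fun x => (C + 1) * abs_approx n ((C + 1)^-1 * f x)).
  apply: expsum_limZ; have ef' := expsum_limZ (C + 1)^-1 ef.
  elim: n {nE} => [|n IH] /=; first exact: expsum_lim_cst.
  apply: expsum_limD => //; apply: expsum_limZ; apply: expsum_limD.
    by apply: expsum_lim_ext (expsum_limM ef' ef') => x; rewrite expr2.
  apply: expsum_lim_ext (expsum_limZ (-1) (expsum_limM IH IH)) => x.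
  by rewrite mulN1r expr2.
move=> x xM; set t := (C + 1)^-1 * f x.
have fE : f x = (C + 1) * t by rewrite mulVKf ?gt_eqF.
have t1 : `|t| <= 1.
  rewrite normrM gtr0_norm ?invr_gt0 // mulrC ler_pdivrMr // mul1r.
  by rewrite (le_trans (fC x xM)) // lerDl.
have [/andP[u0 ut] uE] := abs_approx_bounds n t1.
rewrite fE normrM (gtr0_norm C1) -mulrBr normrM (gtr0_norm C1) ger0_norm ?subr_ge0 //.
rewrite ltr_pdivrMr // in nE.
have n1 : 0 < n.+1%:R :> R by rewrite ltr0n.
rewrite -(ler_pM2r n1).
move: nE uE; rewrite -[n.+2%:R]natr1; set w := `|t| - _; set N : R := n.+1%:R => nE uE.
have w0 : 0 <= w by rewrite subr_ge0.
have : (C + 1) * (w * (N + 1)) <= (C + 1) * 2 by rewrite ler_wpM2l // ltW.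
have : 0 <= (C + 1) * w by rewrite mulr_ge0 // ltW.
by lra.
Qed.

Lemma expsum_lim_max f g :
  expsum_lim f -> expsum_lim g -> expsum_lim (fun x => Num.max (f x) (g x)).
Proof.
move=> ef eg.
apply: (@expsum_lim_ext (fun x => 2^-1 * (f x + g x + `|f x + (-1) * g x|))).
  move=> x; case: leP => fg.
    by rewrite ler0_norm; [field | lra].
  by rewrite gtr0_norm; [field | lra].
apply: expsum_limZ; do 2?apply: expsum_limD => //; apply: expsum_lim_abs.
by apply: expsum_limD => //; exact: expsum_limZ.
Qed.

Lemma expsum_lim_sum (I : Type) (r : seq I) (F : I -> cV -> R) :
  (forall i, expsum_lim (F i)) -> expsum_lim (fun x => \sum_(i <- r) F i x).
Proof.
move=> eF; elim: r => [|i r IH].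
  by apply: expsum_lim_ext (expsum_lim_cst 0) => x; rewrite big_nil.
by apply: expsum_lim_ext (expsum_limD (eF i) IH) => x; rewrite big_cons.
Qed.

(** The net is a grid of mesh [eta]; each coordinate is rounded down to it. *)
Lemma ball_finite_net (M eta : R) : 0 < eta ->
  exists s : seq cV, forall x, `|x| <= M -> exists2 y, y \in s & `|x - y| <= eta.
Proof.
move=> eta0; have [M0|M0] := ltP M 0.
  by exists [::] => x xM; have := le_trans (normr_ge0 x) xM; rewrite leNgt M0.
pose N := Num.truncn (2 * M / eta).
pose G (f : {ffun 'I_d -> 'I_N.+1}) : cV := \col_i (- M + eta * (f i)%:R).
exists (map G (enum {ffun 'I_d -> 'I_N.+1})) => x xM.
pose f := [ffun i => inord (Num.truncn ((x i 0 + M) / eta)) : 'I_N.+1].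
exists (G f); first by rewrite map_f ?mem_enum.
apply: cV_norm_le => [|i]; first exact: ltW.
rewrite !mxE ffunE.
have := le_trans (coord_norm_le x i) xM; rewrite ler_norml => /andP[x1 x2].
have z0 : 0 <= (x i 0 + M) / eta by rewrite divr_ge0 ?(ltW eta0) //; lra.
rewrite inordK; last first.
  by rewrite ltnS le_truncn // ler_pM2r ?invr_gt0 //; lra.
have /andP[] := truncn_itv z0.
rewrite ler_pdivlMr // ltr_pdivrMr // -natr1 => h1 h2.
by rewrite ler_norml; lra.
Qed.

Lemma norm_sum_coord x : `|x| <= \sum_i `|x i 0|.
Proof.
apply: cV_norm_le => [|i]; first exact: sumr_ge0.
by rewrite (bigD1 i) //= lerDl sumr_ge0.
Qed.

(* A K-Lipschitz [f] is the maximum over all [y] of [f y - K |x - y|_1]; a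
   finite net of [y]'s suffices on a ball. *)
Lemma expsum_lim_lipschitz f (K : R) :
  (forall x y, `|f x - f y| <= K * `|x - y|) -> expsum_lim f.
Proof.
move=> fK; apply: expsum_lim_lim => M e e0.
pose K' := `|K| + 1.
have K0 : 0 < K' by rewrite ltr_wpDl.
have fK' x y : `|f x - f y| <= K' * `|x - y|.
  by rewrite (le_trans (fK x y)) // ler_wpM2r // /K' ler_wpDr // ler_norm.
have dp : 0 < K' * (1 + d%:R) by rewrite mulr_gt0 // ltr_pwDl.
(* Passing from [x] to a nearby net point [y] costs [K' |x - y|] in [f] and at most [K' d |x - y|]
   in the penalty. *)
have [s sM] := @ball_finite_net M (e / (K' * (1 + d%:R))) (divr_gt0 e0 dp).
pose g y x := f y - K' * \sum_i `|x i 0 - y i 0|.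
have eg y : expsum_lim (g y).
  apply: (@expsum_lim_ext (fun x => f y + (- K') * \sum_(i <- index_enum 'I_d) `|x i 0 + - y i 0|)).
    by move=> x; rewrite mulNr.
  apply: expsum_limD; first exact: expsum_lim_cst.
  apply: expsum_limZ; apply: expsum_lim_sum => i; apply: expsum_lim_abs.
  by apply: expsum_limD; [exact: expsum_lim_coord | exact: expsum_lim_cst].
have gf y x : g y x <= f x.
  have : f y - f x <= K' * `|y - x| := le_trans (ler_norm _) (fK' y x).
  have : `|x - y| <= \sum_i `|x i 0 - y i 0|.
    rewrite (le_trans (norm_sum_coord _)) //.
    by apply: ler_sum => i _; rewrite !mxE.
  by rewrite /g [`|x - y|]distrC; nra.
(* The maximum is started from [g 0], which is harmless since every [g y] lies below [f]. *)
have [m em [mf mg]] : exists2 m, expsum_lim m &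
    (forall x, m x <= f x) /\ (forall x y, y \in s -> g y x <= m x).
  elim: (s) => [|y r [m em [mf mg]]]; first by exists (g 0); [exact: eg | split].
  exists (fun x => Num.max (g y x) (m x)); first exact: expsum_lim_max.
  split=> [x|x z]; first by rewrite ge_max gf mf.
  by rewrite in_cons le_max => /predU1P[->|/mg->]; rewrite ?lexx ?orbT.
exists m => // x xM; have [y ys] := sM x xM; rewrite ler_pdivlMr // => yx.
rewrite ger0_norm ?subr_ge0 // lerBlDr -lerBlDl; apply: le_trans (mg x y ys).
have : f x - f y <= K' * `|x - y| := le_trans (ler_norm _) (fK' x y).
have : \sum_i `|x i 0 - y i 0| <= d%:R * `|x - y|.
  apply: (@le_trans _ _ (\sum_(i < d) `|x - y|)).
    by apply: ler_sum => i _; have := coord_norm_le (x - y) i; rewrite !mxE.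
  by rewrite sumr_const card_ord mulr_natl.
rewrite /g; move: yx; set S := \sum_i _; set n := `|x - y| => yx h1 h2; nra.
Qed.

End ExpSums.

(** * Fields reached by Euler steps *)

Section Attainable.
Variables (R : realType) (alpha : R) (d : nat).
Hypothesis alpha01 : 0 < alpha < 1.
Local Notation cV := 'cV[R]_d.
Implicit Types (x y : cV) (F G : cV -> cV) (l : 'rV[R]_d).

Definition attainable F := forall M delta : R, 0 < delta ->
  exists2 h0 : R, 0 < h0 & forall h, 0 < h -> h <= h0 ->
  exists2 T, net alpha T &
    forall x, `|x| <= M -> `|T x - x - h *: F x| <= delta * h.

Definition locally_lipschitz F := forall M : R, exists2 C, 0 <= C &
  forall x y, `|x| <= M -> `|y| <= M -> `|F x - F y| <= C * `|x - y|.

(** A field error of [delta / 2] displaces the step by at most [delta / 2 * h], which leaves the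
    other half for the network. *)
Lemma attainable_lim F : (forall M delta : R, 0 < delta ->
    exists2 G, attainable G & forall x, `|x| <= M -> `|F x - G x| <= delta) ->
  attainable F.
Proof.
move=> aF M dl dl0; have dl2 : 0 < dl / 2 by rewrite divr_gt0.
have [G aG FG] := aF M _ dl2; have [h0 h00 H] := aG M _ dl2.
exists h0 => // h hp hh; have [T nT TG] := H h hp hh.
exists T => // x xM.
have -> : T x - x - h *: F x = (T x - x - h *: G x) - h *: (F x - G x).
  by rewrite scalerBr opprB addrA subrK.
rewrite (le_trans (ler_normB _ _)) // (splitr dl) mulrDl lerD ?TG //.
by rewrite normrZ gtr0_norm // mulrC ler_wpM2r ?FG // ltW.
Qed.

Lemma locally_lipschitz_bounded F M : locally_lipschitz F ->
  exists2 C, 0 <= C & forall x, `|x| <= M -> `|F x| <= C.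
Proof.
move=> LF; have [M0|M0] := leP 0 M; last first.
  by exists 0 => // x xM; have := le_trans (normr_ge0 x) xM; rewrite leNgt M0.
have [C C0 FC] := LF M; exists (C * M + `|F 0|) => [|x xM].
  by rewrite addr_ge0 ?mulr_ge0.
rewrite -[F x](subrK (F 0)) (le_trans (ler_normD _ _)) // lerD2r.
by rewrite (le_trans (FC _ _ _ _)) ?normr0 // subr0 ler_wpM2l.
Qed.

Lemma locally_lipschitzD F G : locally_lipschitz F -> locally_lipschitz G ->
  locally_lipschitz (fun x => F x + G x).
Proof.
move=> LF LG M; have [C C0 FC] := LF M; have [D D0 GD] := LG M.
exists (C + D) => [|x y xM yM]; first exact: addr_ge0.
rewrite opprD addrACA (le_trans (ler_normD _ _)) // mulrDl.
by rewrite lerD ?FC ?GD.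
Qed.

(** The two steps are composed. The second field is read at [S x] instead of [x], which costs only
    order [h^2] by its Lipschitz bound. *)
Lemma attainableD F G : locally_lipschitz F -> locally_lipschitz G ->
  attainable F -> attainable G -> attainable (fun x => F x + G x).
Proof.
move=> LF LG aF aG M dl dl0.
have dl3 : 0 < dl / 3 by rewrite divr_gt0.
have [C C0 FC] := locally_lipschitz_bounded M LF.
have [L L0 GL] := LG (M + 1).
have [h1 h10 H1] := aF M _ dl3; have [h2 h20 H2] := aG (M + 1) _ dl3.
pose A := C + dl; have A0 : 0 < A by rewrite ltr_wpDl.
have LA : 0 < L * A + 1 by rewrite ltr_wpDl // mulr_ge0 // ltW.
(* The bound [A^-1] keeps [S x] in the ball of radius [M + 1], and the last bound makes [L * A * h]
   at most [dl / 3]. *)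
exists (Num.min (Num.min h1 h2) (Num.min A^-1 (dl / 3 / (L * A + 1)))).
  by rewrite !lt_min h10 h20 invr_gt0 A0 divr_gt0.
move=> h h0; rewrite !le_min => /andP[/andP[hh1 hh2] /andP[hA hL]].
have [S nS SF] := H1 h h0 hh1; have [T nT TG] := H2 h h0 hh2.
exists (T \o S) => [|x xM /=]; first exact: net_comp.
have SA : `|S x - x| <= h * A.
  rewrite -[S x - x](subrK (h *: F x)) (le_trans (ler_normD _ _)) //.
  have := SF x xM; have := ler_wpM2l (ltW h0) (FC x xM).
  by rewrite normrZ (gtr0_norm h0) /A; nra.
have hA1 : h * A <= 1 by rewrite -ler_pdivlMr // mul1r.
have SM : `|S x| <= M + 1.
  rewrite -[S x](subrK x) (le_trans (ler_normD _ _)) // addrC lerD //.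
  exact: le_trans SA hA1.
have xM1 : `|x| <= M + 1 by rewrite (le_trans xM) // lerDl.
have -> : T (S x) - x - h *: (F x + G x) =
   (T (S x) - S x - h *: G (S x)) + (S x - x - h *: F x) + h *: (G (S x) - G x).
  by apply/matrixP => i j; rewrite !mxE; ring.
rewrite (le_trans (ler_normD _ _)) // (le_trans (lerD (ler_normD _ _) (lexx _))) //.
have g1 := TG _ SM; have g2 := SF _ xM.
have g3 : `|h *: (G (S x) - G x)| <= dl / 3 * h.
  rewrite normrZ (gtr0_norm h0) mulrC ler_wpM2r //; first exact: ltW.
  rewrite (le_trans (GL _ _ SM xM1)) //.
  rewrite (@le_trans _ _ (L * (h * A))) ?ler_wpM2l //.
  rewrite ler_pdivlMr // in hL; nra.
by lra.
Qed.

Lemma attainable0 : attainable (fun=> 0).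
Proof.
move=> M dl dl0; exists 1 => // h h0 _; exists id; first exact: net_id.
by move=> x _; rewrite scaler0 subr0 subrr normr0 mulr_ge0 // ltW.
Qed.

Definition ridge (a : R) l j x : cV := (a * expR (lin l x)) *: ecol R j.

Lemma ridge_locally_lipschitz a l j : locally_lipschitz (ridge a l j).
Proof.
move=> M; have [C C0 lC] := lin_norm_le l.
exists (`|a| * (expR (C * M) * C)) => [|x y xM yM].
  by rewrite !mulr_ge0 ?expR_ge0.
rewrite -scalerBl (le_trans (norm_ecol_le _ _)) // -mulrBr normrM -!mulrA.
have lM z : `|z| <= M -> lin l z <= C * M.
  by move=> zM; rewrite (le_trans (ler_norm _)) // (le_trans (lC _)) // ler_wpM2l.
rewrite ler_wpM2l // (le_trans (expR_lip (lM _ xM) (lM _ yM))) //.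
by rewrite ler_wpM2l ?expR_ge0 // -linBr.
Qed.

Lemma net_shear l (u : cV) : net alpha (fun x => x + lin l x *: u).
Proof.
apply: net_ext (net_affine alpha (1%:M + u *m l) 0) => x.
rewrite addr0 mulmxDl mul1mx -mulmxA; congr (_ + _).
by apply: cV_eq => i; rewrite [LHS]mxE big_ord1 [RHS]mxE mulrC.
Qed.

(* Conjugating by the linear map replacing [x_j] with [lin l x] turns a
   one-variable map into a map with increment along [e_j] depending only on
   [lin l x]. *)
Lemma attainable_ridge_coord a l j : l 0 j != 0 -> attainable (ridge a l j).
Proof.
move=> lj M dl dl0; have /andP[a0 a1] := alpha01.
pose c := l 0 j; have [C C0 lC] := lin_norm_le l.
pose M' := C * `|M| + 1; have M'0 : 0 < M' by rewrite ltr_wpDl // mulr_ge0.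
have c0 : 0 < `|c| by rewrite normr_gt0.
pose B := `|c * a| * expR M'; have B0 : 0 <= B by rewrite mulr_ge0 ?expR_ge0.
(* For such [h] the perturbation in [g] below has Lipschitz constant at most [1 - alpha], so the
   slopes of [g] lie between [alpha] and [2 - alpha <= 1 / alpha]. *)
exists ((1 - alpha) / (B + 1)) => [|h h0].
  by rewrite divr_gt0 ?subr_gt0 // ltr_wpDl.
rewrite ler_pdivlMr ?ltr_wpDl // => hB.
pose g (s : R) := s + c * a * h * expR s.
have e0 : 0 < `|c| * (dl / 2 * h) by rewrite !mulr_gt0.
have gM s t : - M' <= s -> s <= t -> t <= M' ->
    alpha * (t - s) <= g t - g s <= (t - s) / alpha.
  move=> _ st tM.
  have := expR_lip tM (le_trans st tM).
  rewrite (ger0_norm (_ : 0 <= t - s)) ?subr_ge0 // => et.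
  have gE : g t - g s = (t - s) + c * a * h * (expR t - expR s) by rewrite /g; ring.
  have : `|c * a * h * (expR t - expR s)| <= (1 - alpha) * (t - s).
    rewrite normrM normrM (gtr0_norm h0).
    apply: (@le_trans _ _ (`|c * a| * h * (expR M' * (t - s)))).
      by rewrite ler_wpM2l // mulr_ge0 // ltW.
    have -> : `|c * a| * h * (expR M' * (t - s)) = B * h * (t - s) by rewrite /B; ring.
    by rewrite ler_wpM2r ?subr_ge0 //; lra.
  have ts : 0 <= t - s by rewrite subr_ge0.
  rewrite ler_norml gE => /andP[k1 k2]; rewrite ler_pdivlMr //.
  by apply/andP; split; nra.
have [r nr gr] := coord_napprox_monotone d alpha01 M'0 e0 gM.
pose P x := x + lin (l - (ecol R j)^T) x *: ecol R j.
(* [Q] is the inverse of [P]. A change of coordinate [j] by [u] in between becomes [u / c] in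
   [x j 0], which explains the factor [c] in [g] and in the tolerance. *)
pose Q x := x + lin (c^-1 *: ((ecol R j)^T - l)) x *: ecol R j.
pose S := Q \o setc j r \o P.
have nS : napprox alpha S.
  apply: napprox_comp => //; last exact/net_napprox/net_shear.
  by apply: napprox_comp => //; exact/net_napprox/net_shear.
have Pj x : P x j 0 = lin l x.
  by rewrite !mxE eqxx mulr1 linDl linNl lin_coord; ring.
have SE x : S x = x + (c^-1 * (r (lin l x) - lin l x)) *: ecol R j.
  rewrite /S /= /Q /setc Pj linZl linDl linNl lin_coord !linDr !linZr lin_ecol.
  rewrite mxE Pj [((_ - _) *: ecol R j) j 0]mxE [ecol R j j 0]mxE eqxx.
  rewrite /P linDl linNl lin_coord -/c /= mulr1n.
  by apply: cV_eq => i; rewrite !mxE; field.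
have [T nT ST] := nS M _ (mulr_gt0 (divr_gt0 dl0 (ltr0n _ 2)) h0).
exists T => // x xM.
have lM : `|lin l x| <= M'.
  rewrite (le_trans (lC x)) // /M' ler_wpDr // ler_wpM2l //.
  by rewrite (le_trans xM) // ler_norm.
have -> : T x - x - h *: ridge a l j x =
    - (S x - T x) + (S x - x - h *: ridge a l j x).
  by apply/matrixP => i k; rewrite !mxE; ring.
rewrite (le_trans (ler_normD _ _)) // (splitr dl) mulrDl lerD //.
  by rewrite normrN ST.
have -> : S x - x - h *: ridge a l j x =
    (- (c^-1 * (g (lin l x) - r (lin l x)))) *: ecol R j.
  by rewrite SE /ridge /g; apply: cV_eq => i; rewrite !mxE; field.
rewrite (le_trans (norm_ecol_le _ _)) // normrN normrM normfV.
by rewrite ler_pdivrMl // gr.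
Qed.

(** When [l 0 j = 0], that entry of [l] is perturbed by a small [e] and the limit is taken. *)
Lemma attainable_ridge a l j : attainable (ridge a l j).
Proof.
have [lj|lj] := eqVneq (l 0 j) 0; last exact: attainable_ridge_coord.
apply: attainable_lim => M dl dl0; have [C C0 lC] := lin_norm_le l.
pose B := `|a| * (expR (C * `|M| + `|M|) * `|M|).
have B0 : 0 <= B by rewrite !mulr_ge0 ?expR_ge0.
pose e := Num.min 1 (dl / (B + 1)).
have e0 : 0 < e by rewrite lt_min ltr01 divr_gt0 // ltr_wpDl.
have e1 : e <= 1 by rewrite ge_min lexx.
have eB : e * B <= dl.
  have : e * (B + 1) <= dl by rewrite -ler_pdivlMr ?ltr_wpDl // ge_min lexx orbT.
  by lra.
exists (ridge a (l + e *: (ecol R j)^T) j).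
  by apply: attainable_ridge_coord; rewrite !mxE lj eqxx mulr1 add0r gt_eqF.
move=> x xM; rewrite -scalerBl (le_trans (norm_ecol_le _ _)) // -mulrBr normrM.
rewrite linDl linZl lin_coord; apply: le_trans eB.
have xM' : `|x| <= `|M| by rewrite (le_trans xM) // ler_norm.
have xj : `|x j 0| <= `|M| by rewrite (le_trans (coord_norm_le x j)).
have exj : `|e * x j 0| <= e * `|M| by rewrite normrM gtr0_norm // ler_wpM2l // ltW.
have lM : lin l x <= C * `|M|.
  by rewrite (le_trans (ler_norm _)) // (le_trans (lC _)) // ler_wpM2l.
have h1 : lin l x <= C * `|M| + `|M| by rewrite ler_wpDr.
have h2 : lin l x + e * x j 0 <= C * `|M| + `|M|.
  rewrite lerD // (le_trans (ler_norm _)) // (le_trans exj) //.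
  by rewrite ler_piMl.
have -> : e * B = `|a| * (expR (C * `|M| + `|M|) * (e * `|M|)) by rewrite /B; ring.
rewrite ler_wpM2l // (le_trans (expR_lip h1 h2)) // ler_wpM2l ?expR_ge0 //.
by rewrite opprD addrA subrr add0r normrN.
Qed.

(** Local Lipschitz continuity is carried through the induction because adding attainable fields
    requires it. *)
Lemma attainable_expsum f j : expsum f ->
  attainable (fun x => f x *: ecol R j) /\
  locally_lipschitz (fun x => f x *: ecol R j).
Proof.
elim=> [a l|f1 f2 _ [a1 l1] _ [a2 l2]].
  by split; [exact: attainable_ridge | exact: ridge_locally_lipschitz].
rewrite (_ : (fun x => _) = fun x => f1 x *: ecol R j + f2 x *: ecol R j).
  by split; [exact: attainableD | exact: locally_lipschitzD].
by apply/funext => x; rewrite scalerDl.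
Qed.

Lemma attainable_lipschitz F (K : R) :
  (forall x y, `|F x - F y| <= K * `|x - y|) -> attainable F.
Proof.
move=> FK; apply: attainable_lim => M dl dl0.
have eF i : expsum_lim (fun x => F x i 0).
  apply: (@expsum_lim_lipschitz _ _ _ K) => x y; apply: le_trans (FK x y).
  by have := coord_norm_le (F x - F y) i; rewrite !mxE.
have /choice[f fP] i : exists f, expsum f /\
    forall x, `|x| <= M -> `|F x i 0 - f x| <= dl.
  by have [f ef Ff] := eF i M dl dl0; exists f.
exists (fun x => \sum_i f i x *: ecol R i).
  suff [] : attainable (fun x => \sum_i f i x *: ecol R i) /\
      locally_lipschitz (fun x => \sum_i f i x *: ecol R i) by [].
  elim: (index_enum _) => [|i r [IH1 IH2]].
    rewrite (_ : (fun x => _) = fun=> 0); last by apply/funext => x; rewrite big_nil.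
    split; first exact: attainable0.
    by move=> M'; exists 0 => // x y _ _; rewrite subrr normr0 mul0r.
  rewrite (_ : (fun x => _) = fun x => f i x *: ecol R i + \sum_(k <- r) f k x *: ecol R k).
    have [h1 h2] := attainable_expsum i (fP i).1.
    by split; [exact: attainableD | exact: locally_lipschitzD].
  by apply/funext => x; rewrite big_cons.
move=> x xM; apply: cV_norm_le => [|i]; first exact: ltW.
rewrite !mxE summxE (bigD1 i) //= !mxE eqxx mulr1 big1 ?addr0.
  exact: (fP i).2.
by move=> k ki; rewrite !mxE eq_sym (negbTE ki) mulr0.
Qed.

End Attainable.

(** * Solutions of the differential equation *)

Section RealAnalysis.
Variable R : realType.

(** Induction on the exceptional points: one inside the interval splits it in two, and the estimates
    on the halves add up. *)
Lemma mvt_le_finite (f : R -> R) (a b M : R) (S : seq R) : a <= b ->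
  {within `[a, b], continuous f} ->
  (forall t, a < t < b -> t \notin S -> derivable f t 1 /\ 'D_1 f t <= M) ->
  f b - f a <= M * (b - a).
Proof.
elim: S a b => [|p S IH] a b ab cf df.
  have [ab'|ba] := ltP a b; last first.
    by have -> : a = b; [lra | rewrite !subrr mulr0].
  have fd t : t \in `]a, b[%R -> is_derive t 1 f ('D_1 f t).
    by rewrite in_itv /= => /df[//|tf _]; exact: derivableP.
  have [c cab ->] := MVT ab' fd cf.
  rewrite in_itv /= in cab; rewrite ler_wpM2r ?subr_ge0 //.
  by have [] := df c cab.
have [/andP[ap pb]|pab] := boolP (a < p < b); last first.
  apply: IH => // t tab tS; apply: df => //; rewrite in_cons negb_or tS andbT.
  by apply/eqP => tp; move: pab; rewrite -tp tab.
have cfl : {within `[a, p], continuous f}.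
  by apply: continuous_subspaceW cf => t /=; rewrite !in_itv /=; lra.
have cfr : {within `[p, b], continuous f}.
  by apply: continuous_subspaceW cf => t /=; rewrite !in_itv /=; lra.
have dl t : a < t < p -> t \notin S -> derivable f t 1 /\ 'D_1 f t <= M.
  move=> /andP[t1 t2] tS; apply: df; first by rewrite t1 (lt_trans t2).
  by rewrite in_cons negb_or tS andbT lt_eqF.
have dr t : p < t < b -> t \notin S -> derivable f t 1 /\ 'D_1 f t <= M.
  move=> /andP[t1 t2] tS; apply: df; first by rewrite t2 (lt_trans ap).
  by rewrite in_cons negb_or tS andbT gt_eqF.
have := IH a p (ltW ap) cfl dl; have := IH p b (ltW pb) cfr dr; lra.
Qed.

Lemma mvt_abs_finite (f : R -> R) (a b c M : R) (S : seq R) : a <= b ->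
  {within `[a, b], continuous f} ->
  (forall t, a < t < b -> t \notin S ->
     derivable f t 1 /\ `|'D_1 f t - c| <= M) ->
  `|f b - f a - c * (b - a)| <= M * (b - a).
Proof.
move=> ab cf df.
have h1 : f b - f a <= (c + M) * (b - a).
  apply: (mvt_le_finite (S := S) ab cf) => t tab tS; have [d1] := df t tab tS.
  by rewrite ler_norml => /andP[_ h]; split=> //; lra.
have h2 : - f b - - f a <= (M - c) * (b - a).
  apply: (@mvt_le_finite (- f) a b _ S ab) => [|t tab tS].
    by move=> t; apply: continuousN; exact: cf.
  have [d1] := df t tab tS; rewrite ler_norml => /andP[h _]; split.
    exact: derivableN.
  by rewrite deriveN //; lra.
by rewrite ler_norml; apply/andP; split; lra.
Qed.

Lemma near_all_seq (T : Type) (F : set_system T) (I : eqType) (r : seq I)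
  (P : I -> T -> Prop) : Filter F ->
  (forall i, i \in r -> \forall t \near F, P i t) ->
  \forall t \near F, forall i, i \in r -> P i t.
Proof.
move=> FF; elim: r => [|i r IH] rP; first by apply: nearW => t i; rewrite in_nil.
have h1 := rP i (mem_head _ _).
have h2 : \forall t \near F, forall k, k \in r -> P k t.
  by apply: IH => k kr; apply: rP; rewrite in_cons kr orbT.
by apply: filterS2 h1 h2 => t h1 h2 k; rewrite in_cons => /predU1P[->|/h2].
Qed.

(** The step is applied at the supremum of the points where [A] holds. From the left it starts at a
    single earlier point, since [A] may fail at others. *)
Lemma real_induction (tau : R) (A : R -> Prop) : 0 <= tau -> A 0 ->
  (forall s, 0 <= s <= tau -> exists2 h, 0 < h &
     (forall a, 0 <= a -> s - h < a -> a < s -> A a -> A s) /\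
     (A s -> forall b, s < b -> b < s + h -> b <= tau -> A b)) ->
  A tau.
Proof.
move=> tau0 A0 step.
pose E : set R := [set t | 0 <= t <= tau /\ A t].
have E0 : E 0 by split; rewrite ?lexx.
have supE : has_sup E by split; [exists 0 | exists tau => t [/andP[]]].
have c0 : 0 <= sup E by apply: ub_le_sup => //; exact: supE.2.
have ct : sup E <= tau by apply: ge_sup; [exists 0 | move=> t [/andP[]]].
have [h h0 [sl sr]] := step (sup E) (introT andP (conj c0 ct)).
have Ac : A (sup E).
  have [a [/andP[a0 at_] Aa] ha] := sup_adherent h0 supE.
  have ac : a <= sup E by apply: ub_le_sup; [exact: supE.2 | split=> //; rewrite a0].
  have [ac'|ca] := ltP a (sup E); first exact: sl ac' Aa.
  by have <- : a = sup E by apply/le_anti; rewrite ac.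
have [ct'|tc] := ltP (sup E) tau; last first.
  by have <- : sup E = tau by apply/le_anti; rewrite ct.
pose b := Num.min tau (sup E + h / 2).
have cb : sup E < b by rewrite lt_min ct' ltrDl divr_gt0.
have bt : b <= tau by rewrite ge_min lexx.
have bh : b < sup E + h by rewrite gt_min; apply/orP; right; lra.
have Ab := sr Ac b cb bh bt.
have : b <= sup E.
  by apply: ub_le_sup; [exact: supE.2 | split=> //; rewrite bt (le_trans c0) // ltW].
by rewrite leNgt cb.
Qed.

End RealAnalysis.

(** * Gronwall estimates for pairs of solutions *)

Section Solutions.
Variables (R : realType) (d : nat) (tau : R).
Variable v : 'cV[R]_d -> R -> 'cV[R]_d.
Local Notation cV := 'cV[R]_d.
Variable K : R.
Hypothesis K0 : 0 <= K.
Hypothesis vK : forall x y t, 0 < t < tau ->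
  enorm (v x t - v y t) <= K * enorm (x - y).

Lemma lipschitz_norm x y t : 0 < t < tau ->
  `|v x t - v y t| <= K * d%:R * `|x - y|.
Proof.
move=> tt; rewrite (le_trans (norm_enorm _)) // (le_trans (vK _ _ tt)) //.
by rewrite -mulrA ler_wpM2l // enorm_norm.
Qed.

Definition solution (x : R -> cV) := ode_solution tau v (x 0) x.

Lemma coord_within_continuous (A : set R) (x : R -> cV) i :
  {within A, continuous x} -> {within A, continuous (fun t => x t i 0)}.
Proof.
move=> cx t.
exact: (continuous_comp (cx t) (@coord_continuous R d 1 i 0 (x t))).
Qed.

Lemma solution_coord x : solution x -> exists S : seq R, forall i t,
  0 < t < tau -> t \notin S ->
  is_derive t 1 (fun s => x s i 0) (v (x t) t i 0).
Proof.
move=> [_ [_ [S xS]]]; exists S => i t tt tS; have [dx Dx] := xS t tt tS.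
have dxi : derivable (fun s => x s i 0) t 1 by exact: (derivable_mxP _ _ _).1.
apply: DeriveDef => //; rewrite -Dx derive_mx // mxE; congr ('D_1 _ t).
Qed.

Lemma is_derive_sum_sqr (I : Type) (r : seq I) (z : I -> R -> R) (dz : I -> R) (t : R) :
  (forall i, is_derive t 1 (z i) (dz i)) ->
  is_derive t 1 (fun s => \sum_(i <- r) z i s ^+ 2)
    (\sum_(i <- r) 2 * z i t * dz i).
Proof.
move=> zd; elim: r => [|i r IH].
  rewrite big_nil (_ : (fun s => _) = cst 0); first exact: is_derive_cst.
  by apply/funext => s; rewrite big_nil.
rewrite big_cons (_ : (fun s => _) =
  (fun s => z i s ^+ 2) + (fun s => \sum_(j <- r) z j s ^+ 2)); last first.
  by apply/funext => s; rewrite big_cons.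
apply: is_deriveD.
rewrite (_ : (fun s => _) = z i * z i); last by apply/funext => s; rewrite expr2.
apply: is_derive_eq; rewrite /GRing.scale /=; ring.
Qed.

(** The squared distance has derivative [\sum_i 2 z_i z_i'], and each of the [d] terms is at most
    [2 K] times that square. *)
Definition gronwall_rate := 2 * d%:R * K.

(** The function [E u * expR (- c * u)] is nonincreasing. Squaring the norm keeps [E] differentiable
    where the solutions meet. *)
Lemma solution_dist_le x y t : solution x -> solution y -> 0 <= t <= tau ->
  enorm (x t - y t) ^+ 2 <= enorm (x 0 - y 0) ^+ 2 * expR (gronwall_rate * t).
Proof.
move=> sx sy /andP[t0 tt].
pose z i s := x s i 0 - y s i 0.
pose E s := \sum_i z i s ^+ 2.
have EE s : enorm (x s - y s) ^+ 2 = E s.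
  rewrite sqr_sqrtr; last by apply: sumr_ge0 => i _; exact: sqr_ge0.
  by apply: eq_bigr => i _; rewrite !mxE.
rewrite !EE; pose c := gronwall_rate.
have [S xS] := solution_coord sx; have [S' yS] := solution_coord sy.
have dE s : 0 < s < tau -> s \notin S ++ S' ->
    is_derive s 1 (fun u => E u * expR (- c * u))
      ((\sum_i 2 * z i s * (v (x s) s i 0 - v (y s) s i 0) - c * E s) * expR (- c * s)).
  move=> ss; rewrite mem_cat negb_or => /andP[sS sS'].
  have zd i : is_derive s 1 (z i) (v (x s) s i 0 - v (y s) s i 0).
    by apply: is_deriveB; [exact: xS | exact: yS].
  have Ed : is_derive s 1 E (\sum_i 2 * z i s * (v (x s) s i 0 - v (y s) s i 0)).
    exact: is_derive_sum_sqr.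
  have ed : is_derive s 1 (fun u => expR (- c * u)) (- c * expR (- c * s)).
    rewrite (_ : (fun u => _) = expR \o (fun u => - c * u)) //.
    apply: is_derive_eq; rewrite /GRing.scale /=; ring.
  rewrite (_ : (fun u => _) = E * (fun u => expR (- c * u))) //.
  apply: is_derive_eq; rewrite /GRing.scale /=; ring.
have cE : {within `[0, t], continuous (fun u => E u * expR (- c * u))}.
  have cz i : {within `[0, tau], continuous (fun u => z i u ^+ 2)}.
    have czi : {within `[0, tau], continuous (z i)}.
      move=> u; apply: continuousB; apply: coord_within_continuous;
        [exact: sx.1 | exact: sy.1].
    rewrite (_ : (fun u => _) = z i * z i); last by apply/funext => u; rewrite expr2.
    by move=> u; apply: continuousM; exact: czi.
  have cE0 : {within `[0, tau], continuous E}.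
    rewrite /E; elim: (index_enum _) => [|i r IH].
      rewrite (_ : (fun _ => _) = cst 0); first by move=> u; exact: cst_continuous.
      by apply/funext => u; rewrite big_nil.
    rewrite (_ : (fun _ => _) = (fun u => z i u ^+ 2) + (fun u => \sum_(j <- r) z j u ^+ 2)).
      by move=> u; apply: continuousD; [exact: cz | exact: IH].
    by apply/funext => u; rewrite big_cons.
  have ce : {within `[0, tau], continuous (fun u => expR (- c * u))}.
    apply: continuous_subspaceT => u; apply: continuous_comp; last exact: continuous_expR.
    exact: mulrl_continuous.
  apply: (@continuous_subspaceW _ _ _ `[0, tau]).
    by move=> u /=; rewrite !in_itv /=; lra.
  by move=> u; apply: continuousM; [exact: cE0 | exact: ce].
have := mvt_le_finite (M := 0) (S := S ++ S') t0 cE.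
rewrite mul0r mulr0 expR0 mulr1 subr_le0.
have -> : - c * t = - (c * t) by ring.
rewrite expRN ler_pdivrMr ?expR_gt0 //; apply=> s st sS.
have ss : 0 < s < tau by lra.
have D := dE s ss sS; split; first by exact: ex_derive.
rewrite derive_val mulr_le0_ge0 ?expR_ge0 // subr_le0.
have e0 : 0 <= enorm (x s - y s) := sqrtr_ge0 _.
apply: (@le_trans _ _ (\sum_(i < d) 2 * K * enorm (x s - y s) ^+ 2)).
  apply: ler_sum => i _.
  have z1 : `|z i s| <= enorm (x s - y s).
    by have := coord_norm_enorm (x s - y s) i; rewrite !mxE.
  have z2 : `|v (x s) s i 0 - v (y s) s i 0| <= K * enorm (x s - y s).
    have := coord_norm_enorm (v (x s) s - v (y s) s) i; rewrite !mxE => /le_trans.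
    by apply; exact: vK.
  rewrite -!mulrA ler_wpM2l // (le_trans (ler_norm _)) // normrM.
  rewrite expr2 mulrCA.
  by apply: ler_pM.
rewrite sumr_const card_ord EE /c /gronwall_rate -mulr_natl; lra.
Qed.

Lemma solution_dist_bounded M : exists2 B, 0 <= B & forall x y t,
  solution x -> solution y -> `|x 0| <= M -> `|y 0| <= M -> 0 <= t <= tau ->
  enorm (x t - y t) <= B.
Proof.
have [M0|M0] := ltP M 0.
  exists 0 => // x y t _ _ xM; have := le_trans (normr_ge0 _) xM.
  by rewrite leNgt M0.
pose A := (d%:R * (M + M)) ^+ 2 * expR (gronwall_rate * tau).
have A0 : 0 <= A by rewrite mulr_ge0 ?sqr_ge0 ?expR_ge0.
(* A nonnegative number whose square is at most [A] is at most [1 + A]; this avoids a root. *)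
exists (1 + A) => [|x y t sx sy xM yM tt]; first by rewrite addr_ge0.
have h : enorm (x t - y t) ^+ 2 <= A.
  rewrite (le_trans (solution_dist_le sx sy tt)) // ler_pM ?sqr_ge0 ?expR_ge0 //.
    rewrite lerXn2r ?nnegrE ?sqrtr_ge0 ?mulr_ge0 ?addr_ge0 //.
    rewrite (le_trans (enorm_norm _)) // ler_wpM2l //.
    by rewrite (le_trans (ler_normB _ _)) // lerD.
  by rewrite ler_expR ler_wpM2l ?mulr_ge0 //; case/andP: tt.
have e0 : 0 <= enorm (x t - y t) := sqrtr_ge0 _.
by nra.
Qed.

(* The difference with a fixed reference solution is uniformly Lipschitz in
   time even though [v] itself may be unbounded near the breakpoints. *)
Lemma solution_diff_lipschitz M : exists2 C, 0 <= C & forall x y s t,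
  solution x -> solution y -> `|x 0| <= M -> `|y 0| <= M ->
  0 <= s -> s <= t -> t <= tau ->
  `|(x t - y t) - (x s - y s)| <= C * (t - s).
Proof.
have [B B0 HB] := solution_dist_bounded M.
exists (K * B) => [|x y s t sx sy xM yM s0 st tt]; first exact: mulr_ge0.
apply: cV_norm_le => [|i]; first by rewrite !mulr_ge0 // subr_ge0.
have [S xS] := solution_coord sx; have [S' yS] := solution_coord sy.
have cz : {within `[s, t], continuous (fun u => x u i 0 - y u i 0)}.
  apply: (@continuous_subspaceW _ _ _ `[0, tau]).
    by move=> u /=; rewrite !in_itv /=; lra.
  move=> u; apply: continuousB; apply: coord_within_continuous; [exact: sx.1 | exact: sy.1].
have := mvt_abs_finite (c := 0) (M := K * B) (S := S ++ S') st cz.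
rewrite mul0r subr0 !mxE; apply=> u ut; rewrite mem_cat negb_or => /andP[uS uS'].
have uu : 0 < u < tau by lra.
have D : is_derive u 1 (fun u => x u i 0 - y u i 0) (v (x u) u i 0 - v (y u) u i 0).
  by apply: is_deriveB; [exact: xS | exact: yS].
split; first exact: ex_derive.
rewrite derive_val subr0.
have := coord_norm_enorm (v (x u) u - v (y u) u) i; rewrite !mxE => /le_trans; apply.
rewrite (le_trans (vK _ _ uu)) // ler_wpM2l // HB //; lra.
Qed.

End Solutions.

(** * Chaining the steps *)

Section Steps.
Variables (R : realType) (alpha : R) (d : nat) (tau : R).
Variable v : 'cV[R]_d -> R -> 'cV[R]_d.
Local Notation cV := 'cV[R]_d.
Hypothesis alpha01 : 0 < alpha < 1.
Hypothesis tau0 : 0 < tau.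
Variable K : R.
Hypothesis K0 : 0 <= K.
Hypothesis vK : forall x y t, 0 < t < tau ->
  enorm (v x t - v y t) <= K * enorm (x - y).
Variables (Omega : set cV) (M : R) (X : cV -> R -> cV).
Hypothesis OmegaM : forall x, Omega x -> `|x| <= M.
Hypothesis Xsol : forall x, ode_solution tau v x (X x).

Local Notation L := (K * d%:R).

Let X0 x : X x 0 = x. Proof. exact: (Xsol x).2.1. Qed.

Let solX x : solution tau v (X x).
Proof. by rewrite /solution X0; exact: Xsol. Qed.

(** Makes [0] an admissible starting point for the reference trajectory even if [M] is negative. *)
Let M' := `|M|.

Let X0M x : Omega x -> `|X x 0| <= M'.
Proof. by move=> /OmegaM xM; rewrite X0 (le_trans xM) // ler_norm. Qed.

Let X00 : `|X 0 0| <= M'.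
Proof. by rewrite X0 normr0 normr_ge0. Qed.

(** Comparison with the trajectory from [0]: that one is continuous at [s], and the difference is
    Lipschitz in time uniformly over [Omega]. *)
Lemma trajectories_equicontinuous s eta : 0 <= s <= tau -> 0 < eta ->
  exists2 h, 0 < h & forall x t, Omega x -> 0 <= t <= tau -> `|t - s| < h ->
    `|X x t - X x s| <= eta.
Proof.
move=> ss eta0; have eta2 : 0 < eta / 2 by rewrite divr_gt0.
have [C C0 HC] := solution_diff_lipschitz K0 vK M'.
have [h1 h10 H1] : exists2 h, 0 < h & forall t, 0 <= t <= tau -> `|t - s| < h ->
    `|X 0 t - X 0 s| <= eta / 2.
  have /subspace_continuousP/(_ s) := (solX 0).1.
  rewrite /= in_itv /= => /(_ ss)/cvgrPdist_le/(_ _ eta2).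
  rewrite near_withinE => /nbhs_ballP[h /= h0 H]; exists h => // t tt ts.
  rewrite distrC; apply: H; last by rewrite /= in_itv.
  by rewrite /ball /= distrC.
exists (Num.min h1 (eta / 2 / (C + 1))).
  by rewrite lt_min h10 divr_gt0 // ltr_wpDl.
move=> x t Ox tt; rewrite lt_min => /andP[th1].
rewrite ltr_pdivlMr ?ltr_wpDl // => thC.
have h2 : `|(X x t - X 0 t) - (X x s - X 0 s)| <= C * `|t - s|.
  case/andP: tt => t0 tt; case/andP: ss => s0 ss.
  have [ts|st] := leP s t.
    by rewrite ger0_norm ?subr_ge0 // HC // X0M.
  rewrite distrC [`|t - s|]distrC (gtr0_norm (_ : 0 < s - t)) ?subr_gt0 //.
  by apply: HC => //; [exact: X0M | exact: ltW].
have -> : X x t - X x s = (X x t - X 0 t - (X x s - X 0 s)) + (X 0 t - X 0 s).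
  by apply/matrixP => i j; rewrite !mxE; ring.
rewrite (le_trans (ler_normD _ _)) // (splitr eta) lerD ?H1 //.
by rewrite (le_trans h2) // ltW // (le_lt_trans _ thC) // mulrC ler_wpM2l // lerDl.
Qed.

Lemma trajectories_bounded : exists2 B, 0 <= B &
  forall x t, Omega x -> 0 <= t <= tau -> `|X x t| <= B.
Proof.
have [B B0 HB] := solution_dist_bounded K0 vK M'.
have [C HC] : exists C, forall t, 0 <= t <= tau -> `|X 0 t| <= C.
  have : compact (X 0 @` `[0, tau]).
    by apply: continuous_compact; [exact: (solX 0).1 | exact: segment_compact].
  move=> /compact_bounded[C [_ HC]]; exists (C + 1) => t tt.
  by apply: HC; [rewrite ltrDl | exists t; rewrite //= in_itv].
have C0 : 0 <= C by apply: le_trans (HC 0 _); rewrite // lexx ltW.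
exists (B + C) => [|x t Ox tt]; first exact: addr_ge0.
rewrite -[X x t](subrK (X 0 t)) (le_trans (ler_normD _ _)) // lerD ?HC //.
by rewrite (le_trans (norm_enorm _)) // HB // X0M.
Qed.

Let lipv x y t : 0 < t < tau -> `|v x t - v y t| <= L * `|x - y|.
Proof. exact: lipschitz_norm K0 vK x y t. Qed.

Let L0 : 0 <= L. Proof. exact: mulr_ge0. Qed.

(** Continuity in time is known for each fixed [z]; a finite net of the ball and the Lipschitz bound
    in space make it uniform in [z]. *)
Lemma field_equicontinuous s B eta : 0 < s < tau ->
  (forall z, {for s, continuous (v z)}) -> 0 < eta ->
  exists2 h, 0 < h & forall z t, `|z| <= B -> `|t - s| < h ->
    0 < t < tau /\ `|v z t - v z s| <= eta.
Proof.
move=> ss cv eta0; have eta3 : 0 < eta / 3 by rewrite divr_gt0.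
have [r rB] := @ball_finite_net R d B (eta / 3 / (L + 1)) (divr_gt0 eta3 (ltr_wpDl L0 ltr01)).
have : \forall t \near s, forall y, y \in r -> `|v y t - v y s| <= eta / 3.
  apply: (@near_all_seq R (nbhs s) _ r (fun y t => `|v y t - v y s| <= eta / 3)) => y _; have /cvgrPdist_le/(_ _ eta3) := cv y.
  by apply: filterS => t; rewrite distrC.
move=> /nbhs_ballP[h1 /= h10 H1]; case/andP: ss => s0 st.
exists (Num.min h1 (Num.min s (tau - s))).
  by rewrite !lt_min h10 s0 subr_gt0.
move=> z t zB; rewrite !lt_min => /andP[th /andP[]].
rewrite !ltr_norml => /andP[t1 _] /andP[_ t2].
have tt : 0 < t < tau by apply/andP; split; lra.
split=> //; have [y yr] := rB z zB.
rewrite ler_pdivlMr ?ltr_wpDl // => zy.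
have H : `|v y t - v y s| <= eta / 3 by apply: H1 => //; rewrite /ball /= distrC.
have l1 := lipv z y tt; have l2 := @lipv y z s (introT andP (conj s0 st)).
have -> : v z t - v z s = (v z t - v y t) + (v y t - v y s) + (v y s - v z s).
  by apply/matrixP => i j; rewrite !mxE; ring.
rewrite (le_trans (ler_normD _ _)) // (le_trans (lerD (ler_normD _ _) (lexx _))) //.
rewrite [`|y - z|]distrC in l2; have n0 := normr_ge0 (z - y); lra.
Qed.

(* Local truncation error of the Euler step with the field frozen at time [s]. *)
Lemma euler_consistent s eta : 0 < s < tau ->
  (forall z, {for s, continuous (v z)}) -> 0 < eta ->
  exists2 h, 0 < h & forall x a b, Omega x -> `|a - s| < h -> `|b - s| < h ->
    a <= s -> s <= b ->
    0 < a /\ b < tau /\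
    `|X x b - X x a - (b - a) *: v (X x a) s| <= eta * (b - a).
Proof.
move=> ss cv eta0; have eta4 : 0 < eta / 4 by rewrite divr_gt0.
have s01 : 0 <= s <= tau by case/andP: ss => s0 st; rewrite !ltW.
have L1 : 0 < L + 1 by rewrite ltr_wpDl.
have [h1 h10 H1] := trajectories_equicontinuous s01 (divr_gt0 eta4 L1).
have [B B0 HB] := trajectories_bounded.
have [h2 h20 H2] := field_equicontinuous B ss cv eta4.
exists (Num.min h1 h2) => [|x a b Ox]; first by rewrite lt_min h10.
rewrite !lt_min => /andP[ah1 ah2] /andP[bh1 bh2] as_ sb.
have ab : a <= b := le_trans as_ sb.
have z0 : `|0 : cV| <= B by rewrite normr0.
have [/andP[a0 a_t] _] := H2 0 a z0 ah2.
have [/andP[b0 bt] _] := H2 0 b z0 bh2.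
split=> //; split=> //.
have near_s t : a <= t -> t <= b -> `|X x t - X x s| <= eta / 4 / (L + 1).
  move=> at_ tb; apply: H1 => //; first by apply/andP; split; lra.
  by move: ah1 bh1; rewrite !ltr_norml => /andP[? ?] /andP[? ?]; apply/andP; split; lra.
have [S xS] := solution_coord (solX x).
apply: cV_norm_le => [|i]; first by rewrite mulr_ge0 ?subr_ge0 // ltW.
have cx : {within `[a, b], continuous (fun t => X x t i 0)}.
  apply: (@continuous_subspaceW _ _ _ `[0, tau]).
    by move=> u /=; rewrite !in_itv /=; lra.
  exact: coord_within_continuous (solX x).1.
have := mvt_abs_finite (c := v (X x a) s i 0) (M := eta) (S := S) ab cx.
rewrite !mxE [_ * v _ _ _ _]mulrC; apply=> t /andP[at_ tb] tS.
have tt : 0 < t < tau by apply/andP; split; lra.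
have D := xS i t tt tS; split; first exact: ex_derive.
rewrite derive_val.
have := coord_norm_le (v (X x t) t - v (X x a) s) i; rewrite !mxE => /le_trans; apply.
(* The outer two differences are controlled by the Lipschitz bound in space, the middle one by
   continuity in time; each is at most [eta / 4]. *)
have -> : v (X x t) t - v (X x a) s = (v (X x t) t - v (X x s) t) +
    (v (X x s) t - v (X x s) s) + (v (X x s) s - v (X x a) s).
  by apply/matrixP => k j; rewrite !mxE; ring.
rewrite (le_trans (ler_normD _ _)) // (le_trans (lerD (ler_normD _ _) (lexx _))) //.
have n1 := near_s t (ltW at_) (ltW tb); have n2 := near_s a (lexx _) ab.
rewrite ler_pdivlMr // in n1; rewrite distrC ler_pdivlMr // in n2.
have l1 := lipv (X x t) (X x s) tt; have l2 := lipv (X x s) (X x a) ss.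
have [_ l3] : 0 < t < tau /\ `|v (X x s) t - v (X x s) s| <= eta / 4.
  apply: H2; first exact: HB.
  by move: ah2 bh2; rewrite !ltr_norml => /andP[? ?] /andP[? ?]; apply/andP; split; lra.
have p1 := normr_ge0 (X x t - X x s); have p2 := normr_ge0 (X x s - X x a).
lra.
Qed.

(** * Propagation of the approximation error *)

Definition net_within t e :=
  exists2 T, net alpha T & forall x, Omega x -> `|T x - X x t| <= e.

(** One [delta] pays for the truncation error of the Euler step, the other for its realisation by a
    network; [e <= 1] keeps [T x] in the ball where the step was built. *)
Lemma net_within_good_step s delta : 0 < s < tau ->
  (forall z, {for s, continuous (v z)}) -> 0 < delta ->
  exists2 h, 0 < h & forall a b e, `|a - s| < h -> `|b - s| < h ->
    a <= s -> s <= b -> a < b -> e <= 1 -> net_within a e ->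
    net_within b ((1 + L * (b - a)) * e + 2 * delta * (b - a)).
Proof.
move=> ss cv dl0; have [B B0 HB] := trajectories_bounded.
have [h1 h10 H1] := euler_consistent ss cv dl0.
have av : attainable alpha (fun z => v z s).
  apply: (attainable_lipschitz alpha01 (K := L)) => x y; exact: lipv.
have [h2 h20 H2] := av (B + 1) delta dl0.
(* Both [a] and [b] lie within [h2 / 2] of [s], hence [b - a <= h2]. *)
exists (Num.min h1 (h2 / 2)) => [|a b e]; first by rewrite lt_min h10 divr_gt0.
rewrite !lt_min => /andP[ah1 ah2] /andP[bh1 bh2] as_ sb ab e1 [T nT TX].
have h0 : 0 < b - a by rewrite subr_gt0.
have hh : b - a <= h2.
  by move: ah2 bh2; rewrite !ltr_norml => /andP[? ?] /andP[? ?]; lra.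
have [S nS Sv] := H2 (b - a) h0 hh.
exists (S \o T) => [|x Ox /=]; first exact: net_comp.
have [a0 [bt euler]] := H1 x a b Ox ah1 bh1 as_ sb.
have TB : `|T x| <= B + 1.
  rewrite -[T x](subrK (X x a)) (le_trans (ler_normD _ _)) // addrC lerD //.
    by apply: HB => //; apply/andP; split; lra.
  exact: le_trans (TX x Ox) e1.
have step := Sv _ TB; have err := TX x Ox; have lv := lipv (T x) (X x a) ss.
have -> : S (T x) - X x b = (S (T x) - T x - (b - a) *: v (T x) s)
    + (T x - X x a) + (b - a) *: (v (T x) s - v (X x a) s)
    - (X x b - X x a - (b - a) *: v (X x a) s).
  by apply/matrixP => i j; rewrite !mxE; ring.
rewrite (le_trans (ler_normB _ _)) //.
rewrite (le_trans (lerD (ler_normD _ _) (lexx _))) //.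
rewrite (le_trans (lerD (lerD (ler_normD _ _) (lexx _)) (lexx _))) //.
have lv' : `|(b - a) *: (v (T x) s - v (X x a) s)| <= L * (b - a) * e.
  rewrite normrZ (gtr0_norm h0) -mulrA mulrCA ler_wpM2l ?(ltW h0) //.
  by rewrite (le_trans lv) // ler_wpM2l.
lra.
Qed.

Lemma net_within_bad_step s delta : 0 <= s <= tau -> 0 < delta ->
  exists2 h, 0 < h & forall t e, 0 <= t <= tau -> `|t - s| < h ->
    (net_within t e -> net_within s (e + delta)) /\
    (net_within s e -> net_within t (e + delta)).
Proof.
move=> ss dl0; have [h h0 H] := trajectories_equicontinuous ss dl0.
exists h => // t e tt ts; split=> -[T nT TX]; exists T => // x Ox.
  rewrite -[T x](subrK (X x t)) -addrA (le_trans (ler_normD _ _)) // lerD ?TX //.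
  exact: H.
rewrite -[T x](subrK (X x s)) -addrA (le_trans (ler_normD _ _)) // lerD ?TX //.
by rewrite distrC; exact: H.
Qed.

Lemma net_within_le t e e' : e <= e' -> net_within t e -> net_within t e'.
Proof. by move=> ee [T nT TX]; exists T => // x Ox; rewrite (le_trans (TX x Ox)). Qed.

Variable bad : seq R.
Hypothesis v_good : forall s, 0 < s < tau -> s \notin bad ->
  forall z, {for s, continuous (v z)}.
Hypothesis bad0 : 0 \in bad.
Hypothesis badtau : tau \in bad.

(* The error budget at time [t] is [2 delta exp(L t) * budget t]: it grows
   linearly at good times and jumps by 1 both on reaching and on leaving a bad
   time. *)
Definition jumps (r : seq R) (t : R) : R :=
  \sum_(p <- r) ((p < t)%R%:R + (p <= t)%R%:R).
Definition budget t := t + jumps bad t.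

Lemma jumps_le r s t : s <= t -> jumps r s <= jumps r t.
Proof.
move=> st; apply: ler_sum => p _; apply: lerD; rewrite ler_nat.
  by case: (ltP p s) => // ps; rewrite (lt_le_trans ps st).
by case: (leP p s) => // ps; rewrite (le_trans ps st).
Qed.

(** The indicator of [p <= t] switches on when [p] is reached, and that of [p < t] when it is
    left. *)
Lemma jumps_jump r p s t : p \in r -> s < t -> p = s \/ p = t ->
  jumps r s + 1 <= jumps r t.
Proof.
move=> + st pst; elim: r => [//|q r IH]; rewrite in_cons /jumps !big_cons.
have jr := jumps_le r (ltW st).
case/predU1P => [<-|pr].
  rewrite -/(jumps r s) -/(jumps r t).
  case: pst => ->; first by rewrite ltxx lexx st (ltW st) /= mulr0n mulr1n; lra.
  by rewrite ltxx lexx (lt_gtF st) (lt_geF st) /= mulr0n mulr1n; lra.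
rewrite -addrA; apply: lerD; last exact: IH pr.
have := jumps_le [:: q] (ltW st); rewrite /jumps !big_seq1; exact.
Qed.

Lemma budget_le s t : s <= t -> budget s + (t - s) <= budget t.
Proof. by move=> st; rewrite /budget; have := jumps_le bad st; lra. Qed.

Lemma budget_ge0 t : 0 <= t -> 0 <= budget t.
Proof. by move=> t0; rewrite addr_ge0 // sumr_ge0. Qed.

Lemma net_within_budget delta : 0 < delta ->
  2 * delta * expR (L * tau) * budget tau <= 1 ->
  net_within tau (2 * delta * expR (L * tau) * budget tau).
Proof.
move=> dl0 small; pose beta t := 2 * delta * expR (L * t) * budget t.
rewrite -/(beta tau).
(* The exponential absorbs the Lipschitz growth over [[a, b]], and each unit of budget is worth at
   least [2 * delta]. *)
have bump_beta a b : 0 <= a -> a <= b -> forall k, 0 <= k -> budget a + k <= budget b ->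
    beta a * expR (L * (b - a)) + 2 * delta * k <= beta b.
  move=> a0 ab k k0 kb; rewrite /beta.
  have -> : expR (L * b) = expR (L * a) * expR (L * (b - a)).
    by rewrite -expRD; congr expR; ring.
  have e1 : 1 <= expR (L * a) * expR (L * (b - a)).
    rewrite -expRD (le_trans _ (expR_ge1Dx _)) // lerDl.
    by rewrite addr_ge0 // mulr_ge0 // subr_ge0.
  set E := expR (L * a); set F := expR (L * (b - a)); rewrite -/E -/F in e1.
  have -> : 2 * delta * E * budget a * F + 2 * delta * k =
      2 * delta * (E * F * budget a + k) by ring.
  have -> : 2 * delta * (E * F) * budget b = 2 * delta * (E * F * budget b) by ring.
  rewrite ler_wpM2l ?mulr_ge0 ?(ltW dl0) //.
  by nra.
have beta_ge0 a : 0 <= a -> 0 <= beta a.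
  by move=> a0; rewrite !mulr_ge0 ?expR_ge0 ?budget_ge0 // ltW.
have beta_exp a b : 0 <= a -> a <= b -> beta a <= beta a * expR (L * (b - a)).
  move=> a0 ab; rewrite ler_peMr ?beta_ge0 //.
  by rewrite (le_trans _ (expR_ge1Dx _)) // lerDl mulr_ge0 // subr_ge0.
have beta_le a b : 0 <= a -> a <= b -> beta a <= beta b.
  move=> a0 ab; have ba : 0 <= b - a by rewrite subr_ge0.
  have := bump_beta a b a0 ab (b - a) ba (budget_le ab).
  have := beta_exp a b a0 ab; have : 0 <= 2 * delta * (b - a).
    by rewrite !mulr_ge0 // ltW.
  by lra.
have beta1 a : 0 <= a -> a <= tau -> beta a <= 1.
  by move=> a0 at_; exact: le_trans (beta_le _ _ a0 at_) small.
apply: (@real_induction R tau (fun t => net_within t (beta t))).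
- exact: ltW.
- exists id => [|x Ox]; first exact: net_id.
  by rewrite X0 subrr normr0 beta_ge0.
move=> s ss; have [s0 st] := andP ss; have [sb|sb] := boolP (s \in bad).
  have [h h0 H] := net_within_bad_step ss dl0.
  have jump a b : 0 <= a -> a < b -> s = a \/ s = b -> beta a + delta <= beta b.
    move=> a0 ab sab.
    have k : budget a + 1 <= budget b.
      by rewrite /budget; have := jumps_jump sb ab sab; lra.
    have := bump_beta a b a0 (ltW ab) 1 ler01 k.
    have := beta_exp a b a0 (ltW ab).
    by lra.
  exists h => //; split=> [a a0 ha as_ na|ns b sb' bh bt].
    have [|| H' _] := H a (beta a).
    - by rewrite a0 (le_trans (ltW as_)).
    - by rewrite ltr_norml; apply/andP; split; lra.
    by apply: net_within_le (H' na); apply: jump; auto.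
  have [|| _ H'] := H b (beta s).
  - by rewrite bt (le_trans s0) // ltW.
  - by rewrite ltr_norml; apply/andP; split; lra.
  by apply: net_within_le (H' ns); apply: jump; auto.
(* Both endpoints are listed in [bad], so a good time is interior. *)
have s0' : 0 < s.
  by rewrite lt_neqAle s0 andbT; apply: contraNneq sb => <-.
have st' : s < tau.
  by rewrite lt_neqAle st andbT; apply: contraNneq sb => ->.
have ss' : 0 < s < tau by rewrite s0'.
have [h h0 H] := net_within_good_step ss' (v_good ss' sb) dl0.
have good a b : 0 <= a -> a <= b ->
    (1 + L * (b - a)) * beta a + 2 * delta * (b - a) <= beta b.
  move=> a0 ab; apply: le_trans (bump_beta a b a0 ab (b - a) _ (budget_le ab)).
    rewrite lerD2r mulrC ler_wpM2l ?expR_ge1Dx //.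
    exact: beta_ge0.
  by rewrite subr_ge0.
exists h => //; split=> [a a0 ha as_ na|ns b sb' bh bt].
  apply: net_within_le (good a s a0 (ltW as_)) _; apply: H => //.
  - by rewrite ltr_norml; apply/andP; split; lra.
  - by rewrite subrr normr0.
  - exact: ltW.
  - by apply: beta1 => //; lra.
apply: net_within_le (good s b s0 (ltW sb')) _; apply: H => //.
- by rewrite subrr normr0.
- by rewrite ltr_norml; apply/andP; split; lra.
- exact: ltW.
- by apply: beta1 => //; lra.
Qed.

End Steps.

(** * Breakpoints and final assembly *)

Lemma piecewise_smooth_continuous (R : realType) (d : nat) (tau : R)
    (v : 'cV[R]_d -> R -> 'cV[R]_d) :
  piecewise_smooth_in_t tau v ->
  exists bad : seq R, forall s, 0 < s < tau -> s \notin bad ->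
    forall z, {for s, continuous (v z)}.
Proof.
move=> [P vP]; exists P => s /andP[s0 st] sP z.
(* [h] is at most the distance from [s] to any breakpoint, so the window of radius [h] around [s]
   lies in a single piece. *)
have [h h0 hP] : exists2 h, 0 < h & forall p, p \in P -> ~ (s - h < p < s + h).
  elim: P sP {vP} => [|p P IH]; first by exists 1.
  rewrite in_cons negb_or => /andP[sp /IH[h h0 hP]].
  have ps0 : 0 < `|s - p| by rewrite normr_gt0 subr_eq0.
  exists (Num.min h `|s - p|) => [|q]; first by rewrite lt_min h0.
  have m1 : Num.min h `|s - p| <= h by rewrite ge_min lexx.
  have m2 : Num.min h `|s - p| <= `|s - p| by rewrite ge_min lexx orbT.
  rewrite in_cons => /predU1P[->|qP] /andP[q1 q2].
    have : `|s - p| < Num.min h `|s - p| by rewrite ltr_norml; apply/andP; split; lra.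
    by rewrite ltNge m2.
  by apply: (hP q qP); apply/andP; split; lra.
pose a := Num.max 0 (s - h); pose b := Num.min tau (s + h).
have [|||sm _] := vP a b.
- by rewrite le_max lexx.
- by rewrite ge_min lexx.
- move=> p pP /andP[]; rewrite gt_max lt_min => /andP[_ p1] /andP[_ p2].
  by apply: (hP p pP); rewrite p1.
have sab : a < s < b by rewrite gt_max lt_min s0 st; apply/andP; split; lra.
(* The iterate of order 0 is [v z] itself; its differentiability in time gives continuity. *)
have /derivable1_diffP := sm z 0%N s sab; exact: differentiable_continuous.
Qed.

Theorem mainTheorem1 (R : realType) (alpha : R) (d : nat) (tau : R)
    (v : 'cV[R]_d -> R -> 'cV[R]_d) (phi : 'cV[R]_d -> 'cV[R]_d)
    (Omega : set 'cV[R]_d) :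
  0 < alpha < 1 -> (0 < d)%N -> 0 < tau ->
  standing_assumption tau v ->
  is_flow_map tau v phi ->
  compact Omega ->
  forall eps : R, 0 < eps ->
  exists (L : nat) (f : 'cV[R]_d -> 'cV[R]_d),
    in_net_class alpha L f /\
    forall x, Omega x -> enorm (f x - phi x) <= eps.
Proof.
move=> alpha01 d0 tau0 [[K vK] /piecewise_smooth_continuous[bad v_good]].
move=> /choice[X XP] /compact_bounded[M [_ OmegaM]] eps eps0.
have vK' x y t : 0 < t < tau -> enorm (v x t - v y t) <= `|K| * enorm (x - y).
  by move=> tt; rewrite (le_trans (vK x y t tt)) // ler_wpM2r ?sqrtr_ge0 // ler_norm.
have OM x : Omega x -> `|x| <= M + 1 by apply: OmegaM; rewrite ltrDl.
have Xsol x : ode_solution tau v x (X x) := (XP x).1.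
pose bad' := 0 :: tau :: bad.
have v_good' s : 0 < s < tau -> s \notin bad' -> forall z, {for s, continuous (v z)}.
  by move=> ss; rewrite !in_cons !negb_or => /and3P[_ _]; exact: v_good.
have bad0 : 0 \in bad' by rewrite !in_cons eqxx.
have badt : tau \in bad' by rewrite !in_cons eqxx orbT.
have dp : 0 < d%:R :> R by rewrite ltr0n.
pose A := 2 * expR (`|K| * d%:R * tau) * budget bad' tau.
have A0 : 0 <= A by rewrite !mulr_ge0 ?expR_ge0 ?budget_ge0 // ltW.
have A1 : 0 < A + 1 by rewrite ltr_wpDl.
(* [A] does not depend on [delta], so the final error [delta * A] can be kept below 1, as the
   induction requires, and below [eps / d], which pays for the passage to the Euclidean norm. *)
pose delta := Num.min 1 (eps / d%:R) / (A + 1).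
have m0 : 0 < Num.min 1 (eps / d%:R) by rewrite lt_min ltr01 divr_gt0.
have dl0 : 0 < delta by rewrite divr_gt0.
have E : 2 * delta * expR (`|K| * d%:R * tau) * budget bad' tau = delta * A.
  by rewrite /A; ring.
have Am : delta * A <= Num.min 1 (eps / d%:R).
  have : delta * (A + 1) = Num.min 1 (eps / d%:R) by rewrite divfK // gt_eqF.
  by move: (ltW dl0); lra.
have := net_within_budget alpha01 tau0 (normr_ge0 K) vK' OM Xsol v_good' bad0 badt dl0.
rewrite E => H; case: H => [|T [L TL] TX].
  by rewrite (le_trans Am) // ge_min lexx.
exists L, T; split=> // x Ox; rewrite (XP x).2 (le_trans (enorm_norm _)) //.
rewrite mulrC -ler_pdivlMr // (le_trans (TX x Ox)) // (le_trans Am) //.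
by rewrite ge_min lexx orbT.
Qed.
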